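(* Suppose that $x(t)$ and $u(t):=\alpha^{[i]}\,v(t)$, for $t\in[t_{i-1},t_i]$, $i=1,\ldots,N$, solve Problem (PLinf), where $\alpha^{[i]}=\operatorname{ess\,sup}_{t_{i-1}\le t\le t_i}\|u(t)\|_\infty>0$. Then there are an adjoint variable vector $\lambda(t)=(\lambda_1(t),\ldots,\lambda_n(t))$ and a scalar adjoint variable $\mu(t)$ such that, for each $i=1,\ldots,N$, $x(t)$, $v(t)$ and $\alpha^{[i]}$ solve $$\dot{x}(t) = f(x(t),t) + \alpha^{[i]}\,v(t),\qquad x(t_{i-1}) = z_{i-1},\quad x(t_i) = z_i,$$ $$\dot{\lambda}(t) = -f_x(x(t),t)^T\,\lambda(t),$$ $$\dot{\mu}(t) = -1 - \lambda(t)^T v(t),\qquad \mu(t_{i-1}) = 0,\quad \mu(t_i) = 0,$$ where, for $j=1,\ldots,n$, $$v_j(t) = \begin{cases} 1, & \text{if } \lambda_j(t) < 0,\\ -1, & \text{if } \lambda_j(t) > 0,\\ \text{undetermined}, & \text{if } \lambda_j(t) = 0,\end{cases}$$ for a.e. $t\in[t_{i-1},t_i]$, with possible jumps in the values of the adjoint variable vector $\lambda(t)$ at $t_i$, $i=1,\ldots,N-1$.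
   Context: Let $t_0<t_1<\cdots<t_N=:t_f$ be real numbers and let $z_0,\ldots,z_N\in\mathbb{R}^n$ (the skeleton) be given points with $z_i\neq z_{i-1}$ for $i=1,\ldots,N$. Let $f:\mathbb{R}^n\times[t_0,t_f]\to\mathbb{R}^n$, $(x,t)\mapsto f(x,t)$, be continuous, and continuously differentiable in $x$, with Jacobian $f_x(x,t)$ jointly continuous. The interval $[t_{i-1},t_i]$ is called the $i$th stage. Problem (PLinf): minimize $$\sum_{i=1}^N \max_{t_{i-1}\le t\le t_i}\|u(t)\|_\infty$$ over $x\in W^{1,\infty}(t_0,t_f;\mathbb{R}^n)$ and $u\in L^\infty(t_0,t_f;\mathbb{R}^n)$ subject to $\dot x(t)=f(x(t),t)+u(t)$ for a.e. $t\in[t_0,t_f]$ and $x(t_i)=z_i$, $i=0,\ldots,N$. Here $\|\cdot\|_\infty$ is the $\ell_\infty$-norm on $\mathbb{R}^n$, and the maximum is understood as the essential supremum. In stage $i$ one writes $u=\alpha^{[i]}v$ with $|v_j(t)|\le1$ a.e., $j=1,\ldots,n$, where $\alpha^{[i]}$ is the (essential) maximum of $\|u(t)\|_\infty$ over that stage. On each stage $\lambda$ and $\mu$ are in $W^{1,\infty}$ ($\lambda$ may be discontinuous between stages). ''Undetermined'' means only that the condition places no restriction on $v_j(t)$ other than $|v_j(t)|\le 1$. *)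

(* Defs.v *)
From HB Require Import structures.
From mathcomp Require Export all_boot all_order all_algebra.
From mathcomp Require Export all_classical all_reals all_analysis.
From mathcomp Require Export ess_sup_inf.

Set Implicit Arguments.
Unset Strict Implicit.
Unset Printing Implicit Defensive.

Export Order.TTheory GRing.Theory Num.Theory numFieldNormedType.Exports.

Local Open Scope classical_set_scope.
Local Open Scope ring_scope.

Section function_spaces.
Context {R : realType}.

(* Essential supremum of |g| over the interval i. On 'cV[R]_n the library norm
   is the maximum of the absolute values of the entries, i.e. the l_oo norm. *)
Definition ess_norm (V : normedModType R) (i : interval R) (g : R -> V)
    : \bar R :=
  ess_sup (mrestr lebesgue_measure (measurable_itv i))
    (fun t => `|g t|%:E).

(* Elements of L^oo are represented by Borel functions; every class has such a
   representative. *)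
Definition in_Linfty n (i : interval R) (u : R -> 'cV[R]_n) : Prop :=
  (forall j, measurable_fun [set` i] (fun t => u t j 0)) /\
  (ess_norm i u < +oo)%E.

Definition abs_continuous (V : normedModType R) (i : interval R) (x : R -> V)
    : Prop :=
  forall e : R, 0 < e -> exists2 d : R, 0 < d &
    forall (m : nat) (a b : 'I_m -> R),
      (forall k, [/\ a k \in i, b k \in i & a k <= b k]) ->
      trivIset [set: 'I_m] (fun k => [set` `]a k, b k[]) ->
      \sum_(k < m) (b k - a k) < d ->
      \sum_(k < m) `|x (b k) - x (a k)| < e.

(* The Sobolev space W^{1,oo}: absolutely continuous functions with an
   essentially bounded derivative. On an open bounded interval such a function
   extends continuously to the closure, but its values at the endpoints are not
   constrained. *)
Definition in_W1infty (V : normedModType R) (i : interval R) (x : R -> V)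
    : Prop :=
  [/\ abs_continuous i x,
      {ae lebesgue_measure, forall t : R, t \in i -> derivable x t 1}
    & (ess_norm i (derive1 x) < +oo)%E].

(* Jacobian f_x(x, t), with entry (k, j) the partial derivative of f_k with
   respect to x_j. *)
Definition jacobian_x n (f : 'cV[R]_n -> R -> 'cV[R]_n) (x : 'cV[R]_n) (t : R)
    : 'M[R]_n :=
  \matrix_(k, j) 'D_(delta_mx j 0) (fun y : 'cV[R]_n => f y t k 0) x.

End function_spaces.

Section interpolation_problem.
Context {R : realType} (n N : nat).
Variables (T : nat -> R) (z : nat -> 'cV[R]_n).
Variable f : 'cV[R]_n -> R -> 'cV[R]_n.

(* Stages are numbered from 0: stage i is [T i, T i.+1], for i < N. *)

Definition regular_field : Prop :=
  [/\ {within [set p : 'cV[R]_n * R | p.2 \in `[T 0, T N]],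
         continuous (fun p => f p.1 p.2)},
      (forall x t, t \in `[T 0, T N] -> differentiable (fun y => f y t) x)
    & {within [set p : 'cV[R]_n * R | p.2 \in `[T 0, T N]],
         continuous (fun p => jacobian_x f p.1 p.2)}].

Definition PLinf_feasible (x u : R -> 'cV[R]_n) : Prop :=
  [/\ in_W1infty `[T 0, T N] x,
      in_Linfty `[T 0, T N] u,
      {ae lebesgue_measure, forall t : R, t \in `[T 0, T N] ->
         is_derive t (1 : R) x (f (x t) t + u t)}
    & forall i, (i <= N)%N -> x (T i) = z i].

Definition PLinf_cost (u : R -> 'cV[R]_n) : \bar R :=
  (\sum_(i < N) ess_norm `[T i, T i.+1] u)%E.

Definition PLinf_solution (x u : R -> 'cV[R]_n) : Prop :=
  PLinf_feasible x u /\
  forall y w, PLinf_feasible y w -> (PLinf_cost u <= PLinf_cost w)%E.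

End interpolation_problem.

(* Main.v *)
Require Import Defs.
From mathcomp Require Import ring lra.
From mathcomp Require Import measurable_realfun.

(* The nodes x(T i) being prescribed, an optimal control is optimal on every
   stage [a, b] = [T i, T i.+1] separately. Let A(t) = f_x(x(t), t) and let Y be
   the fundamental matrix Y' = - Y A, so that the adjoint arcs are the rows c Y.
   By |u_j| <= alpha, the convex function
     F(c) = int_a^b sum_j (alpha |(c Y)_j| + (c Y)_j u_j) dt
   is nonnegative. If F(c) = 0 for some c <> 0, its integrand vanishes a.e., which
   is the sign condition for lambda = (c Y)^T; rescaling c so that the integral
   of the l_1 norm of lambda is b - a closes mu, as mu' = - 1 + |lambda|_1.
   Otherwise F(c) >= kappa |c| with kappa > 0, and replacing |y| by sqrt(1 + y^2)
   gives a differentiable coercive function, whose critical point c yields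
   w_j = - (c Y)_j / sqrt(1 + (c Y)_j^2) with |w| <= rho < 1 and
   int_a^b Y (alpha w - u) = 0. Hence d' = A d + alpha w - u has a solution with
   d(a) = d(b) = 0. As the control enters additively and acts on every
   coordinate, x + e d is an exact trajectory, no correction of its end point
   being needed; its control (1 - e) u + e alpha w + o(e) is smaller than alpha
   on the stage for small e, which contradicts optimality. *)

Local Open Scope classical_set_scope.
Local Open Scope ring_scope.

Set Implicit Arguments.
Unset Strict Implicit.
Unset Printing Implicit Defensive.

(** * Derivatives and primitives *)

Section matrix_derivatives.
Context {R : realType}.

Lemma is_derive_mxP m n (M : R -> 'M[R]_(m, n)) (D : 'M[R]_(m, n)) (t : R) :
  is_derive t 1 M D <->
  forall i j, is_derive t 1 (fun s => M s i j) (D i j).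
Proof.
split=> [[dM DE] i j|H].
  have dMij := (derivable_mxP M t 1).1 dM.
  by split=> //; rewrite -DE derive_mx// mxE.
have dM : derivable M t 1 by apply/derivable_mxP => i j; have [] := H i j.
split=> //; rewrite derive_mx//; apply/matrixP => i j; rewrite mxE.
by have [_ ->] := H i j.
Qed.

Lemma is_derive_sumE (n : nat) (h : 'I_n -> R -> R) (dh : 'I_n -> R) (t : R) :
  (forall k, is_derive t 1 (h k) (dh k)) ->
  is_derive t 1 (fun s => \sum_k h k s) (\sum_k dh k).
Proof.
move=> H; have := @is_derive_sum _ _ _ n h t 1 dh H.
by congr (is_derive _ _ _ _); apply/funext => s; rewrite fct_sumE.
Qed.

Lemma is_derive_mulE (f g : R -> R) (df dg t : R) :
  is_derive t 1 f df -> is_derive t 1 g dg ->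
  is_derive t 1 (fun s => f s * g s) (df * g t + f t * dg).
Proof.
move=> Hf Hg; have := is_deriveM Hf Hg.
rewrite /GRing.scale/= => H; apply: is_derive_eq H _.
by rewrite addrC [g t * _]mulrC.
Qed.

Lemma is_derive_mulmx m n p (A : R -> 'M[R]_(m, n)) (B : R -> 'M[R]_(n, p))
    (dA : 'M[R]_(m, n)) (dB : 'M[R]_(n, p)) (t : R) :
  is_derive t 1 A dA -> is_derive t 1 B dB ->
  is_derive t 1 (fun s => A s *m B s) (dA *m B t + A t *m dB).
Proof.
move=> /is_derive_mxP HA /is_derive_mxP HB; apply/is_derive_mxP => i j.
rewrite !mxE -big_split/=.
under [X in is_derive _ _ X _]eq_fun do rewrite mxE.
by apply: is_derive_sumE => k; exact: is_derive_mulE.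
Qed.

Lemma is_derive_trmx m n (A : R -> 'M[R]_(m, n)) (dA : 'M[R]_(m, n)) (t : R) :
  is_derive t 1 A dA -> is_derive t 1 (fun s => (A s)^T) dA^T.
Proof.
move=> /is_derive_mxP HA; apply/is_derive_mxP => i j; rewrite mxE.
by under [X in is_derive _ _ X _]eq_fun do rewrite mxE.
Qed.

Lemma is_derive_continuous (V : normedModType R) (f : R -> V) (df : V) (t : R) :
  is_derive t 1 f df -> {for t, continuous f}.
Proof.
move=> [d _]; apply: differentiable_continuous; exact/derivable1_diffP.
Qed.

Lemma continuous_mxP (T : topologicalType) m n (M : T -> 'M[R]_(m, n)) (t : T) :
  {for t, continuous M} <->
  forall i j, {for t, continuous (fun s => M s i j)}.
Proof.
split=> [cM i j|cM].
  apply: (@continuous_comp _ _ _ M (fun N : 'M[R]_(m, n) => N i j)) => //.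
  exact: coord_continuous.
apply/cvgrPdist_le => e e0.
have : \forall s \near t, forall ij, `|M t ij.1 ij.2 - M s ij.1 ij.2| <= e.
  apply: filter_forall => -[i j] /=.
  by have /cvgrPdist_le/(_ e e0) := cM i j.
apply: filterS => s H.
rewrite /Num.Def.normr/= mx_normrE (bigmax_le _ (ltW e0))//= => i _.
by rewrite !mxE.
Qed.

Lemma continuous_sumE (T : topologicalType) n (h : 'I_n -> T -> R) (t : T) :
  (forall k, {for t, continuous (h k)}) ->
  {for t, continuous (fun s => \sum_k h k s)}.
Proof. by move=> H; apply: cvg_big => // [[x y]|k _]; [exact: add_continuous|exact: H]. Qed.

Lemma continuous_mulmx (T : topologicalType) m n p (A : T -> 'M[R]_(m, n))
    (B : T -> 'M[R]_(n, p)) (t : T) :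
  {for t, continuous A} -> {for t, continuous B} ->
  {for t, continuous (fun s => A s *m B s)}.
Proof.
move=> /continuous_mxP cA /continuous_mxP cB; apply/continuous_mxP => i j.
have -> : (fun s => (A s *m B s) i j) = fun s => \sum_k A s i k * B s k j.
  by apply/funext => s; rewrite mxE.
by apply: continuous_sumE => k; apply: cvgM; [exact: cA|exact: cB].
Qed.

(** The bound [|df| <= dg] makes both [g - f] and [g + f] nondecreasing; the two resulting
    inequalities bound [|f t - f s|]. *)
Lemma comparison (f g df dg : R -> R) (a b s t : R) :
  (forall x, x \in `]a, b[ -> is_derive x 1 f (df x)) ->
  (forall x, x \in `]a, b[ -> is_derive x 1 g (dg x)) ->
  {within `[a, b], continuous f} -> {within `[a, b], continuous g} ->
  (forall x, x \in `]a, b[ -> `|df x| <= dg x) ->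
  a <= s -> s <= t -> t <= b -> `|f t - f s| <= g t - g s.
Proof.
move=> Df Dg cf cg H as_ st tb.
have P : g s - f s <= g t - f t.
  apply: (@ger0_derive1_ndecr _ (g - f) a b) => //.
  - by move=> x xab; apply: derivableB; [have [] := Dg x xab|have [] := Df x xab].
  - move=> x xab; have [df1 df2] := Df x xab; have [dg1 dg2] := Dg x xab.
    rewrite derive1E deriveB// df2 dg2 subr_ge0.
    by apply: le_trans (H x xab); exact: ler_norm.
  - by move=> x; apply: cvgB; [exact: cg|exact: cf].
have Q : g s + f s <= g t + f t.
  apply: (@ger0_derive1_ndecr _ (g + f) a b) => //.
  - by move=> x xab; apply: derivableD; [have [] := Dg x xab|have [] := Df x xab].
  - move=> x xab; have [df1 df2] := Df x xab; have [dg1 dg2] := Dg x xab.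
    rewrite derive1E deriveD// df2 dg2 -lerBlDr sub0r.
    by apply: le_trans (H x xab); rewrite -normrN ler_norm.
  - by move=> x; apply: cvgD; [exact: cg|exact: cf].
rewrite ler_norml; apply/andP; split; lra.
Qed.

End matrix_derivatives.

(** * Almost-everywhere statements for Lebesgue measure *)

Section lebesgue_ae.
Context {R : realType}.
Implicit Types P Q : R -> Prop.

Lemma lebesgue_aeS P Q : (forall t, P t -> Q t) ->
  {ae lebesgue_measure, forall t, P t} -> {ae lebesgue_measure, forall t, Q t}.
Proof.
move=> PQ; apply: filterS; first exact: (ae_filter_ringOfSetsType lebesgue_measure).
exact: PQ.
Qed.

Lemma lebesgue_aeI P Q : {ae lebesgue_measure, forall t, P t} ->
  {ae lebesgue_measure, forall t, Q t} ->
  {ae lebesgue_measure, forall t, P t /\ Q t}.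
Proof.
by apply: filterI; exact: (ae_filter_ringOfSetsType lebesgue_measure).
Qed.

Lemma lebesgue_ae_nearW P : (forall t, P t) -> {ae lebesgue_measure, forall t, P t}.
Proof.
move=> HP; apply: filterE; last exact: HP.
exact: (ae_filter_ringOfSetsType lebesgue_measure).
Qed.

Lemma lebesgue_ae_neq (a : R) : {ae lebesgue_measure, forall t : R, t != a}.
Proof.
exists [set a]; split => //; first by rewrite lebesgue_measure_set1.
by move=> t /= /negP; rewrite negbK => /eqP.
Qed.

End lebesgue_ae.

(* The lower bound makes one formula serve on both sides of a; for locally
   integrable g any other lower bound below a and t gives the same value. *)
Definition primitive {R : realType} (a : R) (g : R -> R) (t : R) : R :=
  \int[lebesgue_measure]_(s in `[Num.min a t - 1, t]) g s
  - \int[lebesgue_measure]_(s in `[Num.min a t - 1, a]) g s.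

Section primitive.
Context {R : realType}.
Local Notation mu := (@lebesgue_measure R).
Variables (g : R -> R) (K : R) (a : R).
Hypothesis mg : measurable_fun [set: R] g.
Hypothesis gK : forall t, `|g t| <= K.

Lemma itv_integrable_bounded (c d : R) : mu.-integrable `[c, d] (EFin \o g).
Proof.
apply: measurable_bounded_integrable => //.
-
 rewrite /= lebesgue_measure_itv/=; case: ifP => _ //.
  by rewrite -EFinD ltry.
- exact: measurable_funTS.
- exists K; split; first exact: num_real.
  by move=> x Kx t _; apply: le_trans (gK t) (ltW Kx).
Qed.

Let I c t := \int[mu]_(s in `[c, t]) g s.

Let I_sub c s t : c <= s -> s <= t -> I c t - I c s = I s t.
Proof.
move=> cs st; rewrite /I Rintegral_itvB//=; last exact: itv_integrable_bounded.
rewrite Rintegral_itv_obnd_cbnd//.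
by apply: integrableS (itv_integrable_bounded s t) => //; apply: subset_itv_oc_cc.
Qed.

Let norm_I s t : s <= t -> `|I s t| <= K * (t - s).
Proof.
move=> st; have gi := itv_integrable_bounded s t.
apply: le_trans (le_normr_Rintegral _ gi) _ => //.
have -> : K * (t - s) = \int[mu]_(x in `[s, t]) K.
  rewrite Rintegral_cst//= lebesgue_measure_itv/= lte_fin.
  by case: ltP => // ts; rewrite (@le_anti _ _ s t) ?st// subrr.
have iK : mu.-integrable `[s, t] (EFin \o cst K).
  apply: measurable_bounded_integrable => //.
  - by rewrite /= lebesgue_measure_itv/=; case: ifP => _ //; rewrite -EFinD ltry.
  - exists `|K|; split; first exact: num_real.
    by move=> x Kx t' _; exact: ltW.
by apply: (@le_Rintegral _ _ _ mu `[s, t]%classic (fun x => `|g x|) (cst K) _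
  (integrable_norm gi) iK) => // x _; exact: gK.
Qed.

Local Notation G := (primitive a g).

(** The base point must lie strictly below [t], since the fundamental theorem of calculus is applied
    at [t]. *)
Let base_le t : Num.min a t - 1 <= a /\ Num.min a t - 1 < t.
Proof.
have [] : Num.min a t <= a /\ Num.min a t <= t by rewrite !ge_min !lexx orbT.
by split; lra.
Qed.

(** Moving the base point adds the same amount to both integrals. *)
Let GE c t : c <= a -> c <= t -> G t = I c t - I c a.
Proof.
move=> ca ct.
suff H d d' : d <= d' -> d' <= a -> d' <= t ->
    I d t - I d a = I d' t - I d' a.
  rewrite /primitive -/(I _ _) -/(I _ _).
  have [ma mt] : Num.min a t - 1 <= a /\ Num.min a t - 1 <= t.
    by have [? /ltW] := base_le t.
  by have [dc|/ltW cd] := leP (Num.min a t - 1) c; [exact: H|apply/esym/H].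
move=> dd' d'a d't.
by rewrite -(I_sub dd' d't) -(I_sub dd' d'a) opprB addrA addrNK.
Qed.

(** The Lipschitz bound comes from [|g| <= K]. The derivative exists at every Lebesgue point of [g]:
    almost everywhere by Lebesgue differentiation, and at every point of continuity. *)
Lemma primitiveP :
  [/\ G a = 0,
      forall s t, s <= t -> `|G t - G s| <= K * (t - s),
      {ae mu, forall t : R, is_derive t 1 G (g t)},
      forall t : R, {for t, continuous g} -> is_derive t 1 G (g t) &
      forall b, a <= b -> G b = \int[mu]_(s in `[a, b]) g s].
Proof.
have der (t : R) : lebesgue_pt g t -> is_derive t 1 G (g t).
  move=> gt; pose c := Num.min a t - 1.
  have [ca ct] : c <= a /\ c < t := base_le t.
  have [] := @FTC1_lebesgue_pt _ g (BLeft c) t (t + 1) _ (itv_integrable_bounded _ _) _ gt.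
  - by rewrite ltrDl.
  - by rewrite lte_fin.
  set F := fun y : R => _ => dF; rewrite derive1E => F'.
  have dF' : is_derive t 1 (fun s => F s - I c a) (g t).
    have := @is_deriveB _ _ _ F (cst (I c a)) t 1 (g t) 0.
    by rewrite subr0; apply => //; split.
  (* The base point in [primitive] varies with the argument; near [t] the fixed [c] may replace
     it. *)
  apply: near_eq_is_derive dF'.
  near=> s; rewrite (@GE c)//.
  by apply/ltW; near: s; exact: lt_nbhsr.
split.
- by rewrite /primitive subrr.
- move=> s t st; pose c := Num.min a s - 1.
  have [ca /ltW cs] : c <= a /\ c < s := base_le s.
  rewrite (GE ca (le_trans cs st)) (GE ca cs) opprB addrA addrNK I_sub//.
  exact: norm_I.
- have lg : locally_integrable [set: R] g.
    split => //; first exact: openT.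
    move=> k _ kk; have [M [_ HM]] := compact_bounded kk.
    have kM : k `<=` `[- (M + 1), M + 1].
      move=> x kx; rewrite /= in_itv/= -ler_norml.
      by apply: (HM (M + 1)) => //; rewrite ltrDl.
    have /integrableP[_] := itv_integrable_bounded (- (M + 1)) (M + 1).
    apply: le_lt_trans; apply: ge0_subset_integral => //=.
    + exact: compact_measurable.
    + by apply/measurable_EFinP; apply: measurableT_comp => //; exact: measurable_funTS.
  by apply: lebesgue_aeS (lebesgue_differentiation lg) => t; exact: der.
- move=> t ct; apply: der; apply: (@continuous_lebesgue_pt _ _ t (ball t 1)) => //.
  + exact: ball_open_nbhs.
  + exact: measurable_ball.
  + exact: measurable_funTS.
- move=> b ab; rewrite (GE (lexx a) ab) /I.
  by rewrite [X in _ - X](_ : _ = 0) ?subr0// set_itv1 Rintegral_set1.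
Unshelve. all: by end_near. Qed.

End primitive.

(** * Clamping to an interval *)

Section clamp.
Context {R : realType}.
Implicit Types a b s t : R.

(** Nearest-point projection onto [[a, b]]. Composing with it extends a function continuous on
    [[a, b]] to a bounded continuous function on the line. *)
Definition clamp a b t := Num.max a (Num.min b t).

Lemma clamp_itv a b t : a <= b -> clamp a b t \in `[a, b].
Proof.
by move=> ab; rewrite in_itv/= /clamp le_max lexx/= ge_max ab ge_min lexx.
Qed.

Lemma clamp_id a b t : t \in `[a, b] -> clamp a b t = t.
Proof.
by rewrite in_itv/= => /andP[at_ tb]; rewrite /clamp min_r// max_r.
Qed.

Lemma clamp_le a b t : a <= b -> t <= a -> clamp a b t = a.
Proof.
by move=> ab ta; rewrite /clamp max_l// ge_min ta orbT.
Qed.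

Lemma clamp_ge a b t : a <= b -> b <= t -> clamp a b t = b.
Proof. by move=> ab bt; rewrite /clamp min_l// max_r. Qed.

Lemma clamp_lip a b s t : s <= t -> 0 <= clamp a b t - clamp a b s <= t - s.
Proof.
move=> st; rewrite /clamp.
rewrite /Order.max /Order.min; apply/andP.
by case: (ltP b t) => ?; case: (ltP b s) => ?; do ![case: ltP => ?]; split; lra.
Qed.

Lemma lipschitz_continuous (V W : normedModType R) (f : V -> W) (K : R) :
  (forall s t : V, `|f t - f s| <= K * `|t - s|) -> continuous f.
Proof.
move=> H t; apply/cvgrPdist_le => e e0.
have K1 : 0 < `|K| + 1 by rewrite ltr_wpDl.
near=> s; apply: le_trans (H _ _) _.
apply: (@le_trans _ _ ((`|K| + 1) * `|t - s|)).
  by rewrite ler_wpM2r// (le_trans (ler_norm K))// lerDl.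
rewrite -ler_pdivlMl// mulrC.
near: s; apply: cvgr_dist_le => //; by rewrite divr_gt0.
Unshelve. all: by end_near. Qed.

Lemma clamp_continuous a b : continuous (clamp a b).
Proof.
apply: (@lipschitz_continuous _ _ _ 1) => s t; rewrite mul1r.
have [st|ts] := leP s t.
  have /andP[? ?] := clamp_lip a b st.
  by rewrite !ger0_norm// subr_ge0.
have /andP[? ?] := clamp_lip a b (ltW ts).
by rewrite [leLHS]distrC [leRHS]distrC !ger0_norm// subr_ge0 ltW.
Qed.

Lemma continuous_clamp (T : topologicalType) (f : R -> T) a b : a <= b ->
  {within `[a, b], continuous f} -> continuous (f \o clamp a b).
Proof.
move=> ab /subspace_continuousP cf t A /(cf _ (clamp_itv t ab)) HA.
have H : nbhs t (clamp a b @^-1` [set s | s \in `[a, b] -> A (f s)]).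
  exact: (clamp_continuous HA).
have := H; apply: filterS => s /= As; apply: As; exact: clamp_itv.
Qed.

Lemma clamp_bounded (V : normedModType R) (f : R -> V) a b : a <= b ->
  {within `[a, b], continuous f} -> exists2 K, 0 < K & forall t, `|f (clamp a b t)| <= K.
Proof.
move=> ab cf.
have [c _ Hc] : exists2 c, c \in `[a, b] & forall t, t \in `[a, b] -> `|f t| <= `|f c|.
  apply: EVT_max => // x.
  apply: (@continuous_comp (subspace `[a, b]%classic) V R f (fun y => `|y|)); first exact: cf.
  exact: norm_continuous.
exists (`|f c| + 1); first by rewrite ltr_wpDl.
by move=> t; rewrite (le_trans (Hc _ (clamp_itv _ ab)))// lerDl.
Qed.

End clamp.

Section matrix_bounds.
Context {R : realType}.

Lemma mx_entry_le m n (M : 'M[R]_(m, n)) i j : `|M i j| <= `|M|.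
Proof.
rewrite [leRHS]/Num.Def.normr/= mx_normrE.
exact: (le_bigmax _ (fun ij => `|M ij.1 ij.2|) (i, j)).
Qed.

Lemma mx_norm_le m n (M : 'M[R]_(m, n)) K : 0 <= K ->
  (forall i j, `|M i j| <= K) -> `|M| <= K.
Proof.
by move=> K0 H; rewrite [leLHS]/Num.Def.normr/= mx_normrE (bigmax_le _ K0).
Qed.

Lemma mulmx_norm_le m n p (A : 'M[R]_(m, n)) (B : 'M[R]_(n, p)) :
  `|A *m B| <= n%:R * `|A| * `|B|.
Proof.
apply: mx_norm_le => [|i j]; first by rewrite !mulr_ge0.
rewrite mxE (le_trans (ler_norm_sum _ _ _))//.
rewrite -mulrA -[n in n%:R](card_ord n) mulr_natl -sumr_const ler_sum// => k _.
by rewrite normrM ler_pM// mx_entry_le.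
Qed.

End matrix_bounds.

(** * Linear differential equations *)

Definition mx_primitive {R : realType} m n (a : R) (F : R -> 'M[R]_(m, n)) (t : R) :=
  \matrix_(i, j) primitive a (fun s => F s i j) t.

Section mx_primitive.
Context {R : realType} (m n : nat) (a : R) (F : R -> 'M[R]_(m, n)) (K : R).
Hypothesis cF : continuous F.
Hypothesis FK : forall t, `|F t| <= K.

Lemma mx_primitive_derive (t : R) : is_derive t 1 (mx_primitive a F) (F t).
Proof.
apply/is_derive_mxP => i j.
under [X in is_derive _ _ X _]eq_fun do rewrite mxE.
have cij : continuous (fun s => F s i j).
  by move=> s; have /continuous_mxP := @cF s; exact.
have [//|s|_ _ _ + _] := @primitiveP _ (fun s => F s i j) K a.
- exact: continuous_measurable_fun.
- exact: le_trans (mx_entry_le _ _ _) (FK s).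
- by apply; exact: cij.
Qed.

Lemma mx_primitive0 : mx_primitive a F a = 0.
Proof. by apply/matrixP => i j; rewrite !mxE /primitive subrr. Qed.

End mx_primitive.

(** The matrix norm is the largest absolute value of an entry, so [comparison] applies entry by
    entry. *)
Lemma mx_comparison {R : realType} m n (P dP : R -> 'M[R]_(m, n)) (g dg : R -> R) (a b s t : R) :
  (forall x, x \in `[a, b] -> is_derive x 1 P (dP x)) ->
  (forall x, x \in `[a, b] -> is_derive x 1 g (dg x)) ->
  (forall x, x \in `[a, b] -> `|dP x| <= dg x) ->
  a <= s -> s <= t -> t <= b -> `|P t - P s| <= g t - g s.
Proof.
move=> DP Dg H as_ st tb.
have sub : {subset `]a, b[ <= `[a, b]} by exact: subset_itv_oo_cc.
have cg : {within `[a, b], continuous g}.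
  by apply: derivable_within_continuous => x /Dg[].
have cmp i j : `|P t i j - P s i j| <= g t - g s.
  have Dij x : x \in `[a, b] -> is_derive x 1 (fun x => P x i j) (dP x i j).
    by move=> /DP /is_derive_mxP.
  have H1 x : x \in `]a, b[ -> is_derive x 1 (fun x => P x i j) (dP x i j).
    by move=> /sub; exact: Dij.
  have H2 x : x \in `]a, b[ -> is_derive x 1 g (dg x) by move=> /sub; exact: Dg.
  have H3 : {within `[a, b], continuous (fun x => P x i j)}.
    by apply: derivable_within_continuous => x /Dij[].
  have H4 x : x \in `]a, b[ -> `|dP x i j| <= dg x.
    by move=> /sub xab; apply: le_trans (H _ xab); exact: mx_entry_le.
  exact: (comparison H1 H2 H3 cg H4 as_ st tb).
apply: mx_norm_le => [|i j]; last by rewrite !mxE.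
(* It remains to see [0 <= g t - g s], which the entries cannot give for an empty matrix; the zero
   function is compared with [g]. *)
have H1 x : x \in `]a, b[ -> is_derive x 1 (cst 0 : R -> R) ((fun=> 0) x).
  by move=> _; exact: is_derive_cst.
have H2 x : x \in `]a, b[ -> is_derive x 1 g (dg x) by move=> /sub; exact: Dg.
have H3 : {within `[a, b], continuous (cst 0 : R -> R)}.
  by apply: continuous_subspaceT => x; exact: cst_continuous.
have H4 x : x \in `]a, b[ -> `|(fun=> 0 : R) x| <= dg x.
  by move=> /sub xab; rewrite normr0 (le_trans _ (H _ xab)).
by have := comparison H1 H2 H3 cg H4 as_ st tb; rewrite /cst subrr normr0.
Qed.

Lemma cvg_geometric_half {R : realType} (K : R) :
  (fun k => K * 2^-1 ^+ k) @ \oo --> (0 : R).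
Proof.
have := @cvg_geometric R K (2^-1); rewrite /geometric; apply.
by rewrite ger0_norm ?invr_ge0// invf_lt1// ltr1n.
Qed.

Section linear_ode.
Context {R : realType} (n : nat) (B : R -> 'M[R]_n) (a b : R).
Hypothesis ab : a <= b.
Hypothesis cB : {within `[a, b], continuous B}.

Let B' := B \o clamp a b.

(** The terms of the Peano-Baker series, each the integral from [a] of [B'] times the preceding one;
    the clamp freezes them outside [[a, b]]. *)
Let Y := fix Y k : R -> 'M[R]_n :=
  if k is k'.+1 then fun t => mx_primitive a (fun s => B' s *m Y k' s) (clamp a b t)
  else fun=> 1%:M.

(** The sum of the series solves the integral equation [Z = 1 + int_a B Z]. Sizes are measured
    against the weight exp(2 L (t - a)), for which each integration gains a factor 1/2. *)
Lemma linear_ode : exists Z : R -> 'M[R]_n,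
  Z a = 1%:M /\ forall t : R, t \in `[a, b] -> is_derive t 1 Z (B t *m Z t).
Proof.
have cB' : continuous B' := continuous_clamp ab cB.
have [C C0 HC] := clamp_bounded ab cB.
(* [q] bounds left multiplication by [B'], and [L > q] yields the contraction factor
   [q / (2 L) <= 1 / 2]. *)
pose q := n%:R * C; pose L := q + 1.
have q0 : 0 <= q by rewrite mulr_ge0// ltW.
pose w t := expR (2 * L * (t - a)).
have w_gt0 t : 0 < w t by exact: expR_gt0.
have w_le s t : s <= t -> w s <= w t.
  by move=> st; rewrite /w ler_expR ler_pM2l ?mulr_gt0 ?ltr_wpDl// lerB.
have dw c (t : R) : is_derive t 1 (fun t => c * w t) (c * (2 * L) * w t).
  have h : is_derive t 1 (fun t : R => 2 * L * (t - a)) (2 * L).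
    have := is_deriveZ (2 * L) (@is_deriveB _ _ _ id (cst a) t 1 1 0 _ _).
    rewrite subr0 /GRing.scale/= mulr1; exact.
  have h2 : is_derive t 1 w (2 * L * w t).
    apply: (is_derive_eq (is_derive1_comp (is_derive_expR _) h)).
    by rewrite mulrC.
  apply: (is_derive_eq (is_deriveZ c h2)).
  by rewrite /GRing.scale/= mulrA.
have BY_le t (M : 'M[R]_n) : `|B' t *m M| <= q * `|M|.
  rewrite (le_trans (mulmx_norm_le _ _))// ler_wpM2r// ler_wpM2l//.
  exact: HC.
have wa : w a = 1 by rewrite /w subrr mulr0 expR0.
have cl t : a <= clamp a b t <= b by have := clamp_itv t ab; rewrite in_itv.
have HY k : continuous (Y k) /\
    forall t, `|Y k t| <= 2^-1 ^+ k * w (clamp a b t).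
  elim: k => [|k [cY bY]].
    split=> t; first exact: cst_continuous.
    rewrite expr0 mul1r; apply: (@le_trans _ _ 1).
      by apply: mx_norm_le => // i j; rewrite mxE; case: eqP; rewrite ?normr1 ?normr0.
    by rewrite -wa w_le//; have /andP[] := cl t.
  pose F s := B' s *m Y k s.
  have cF : continuous F by move=> t; apply: continuous_mulmx; [exact: cB'|exact: cY].
  have bF s : `|F s| <= q * (2^-1 ^+ k * w b).
    rewrite (le_trans (BY_le _ _))// ler_wpM2l// (le_trans (bY _))//.
    by rewrite ler_wpM2l// ?exprn_ge0// w_le//; have /andP[] := cl s.
  have dF := mx_primitive_derive a cF bF.
  split=> [t|t].
    apply: (@continuous_comp _ _ _ (clamp a b) (mx_primitive a F)).
      exact: clamp_continuous.
    exact: is_derive_continuous (dF _).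
  have /andP[acl clb] := cl t.
  (* The derivative of [2^-(k+1) w] is [L 2^-k w], which dominates [q] times the bound on [Y k]. *)
  have := @mx_comparison R n n (mx_primitive a F) F
    (fun t => 2^-1 ^+ k.+1 * w t) _ a b a (clamp a b t)
    (fun x _ => dF x) (fun x _ => dw _ x) _ (lexx a) acl clb.
  rewrite mx_primitive0 subr0 => H; apply: (le_trans (H _)); last first.
    by rewrite lerBlDr lerDl mulr_ge0 ?exprn_ge0// ltW.
  move=> x xab; rewrite (le_trans (BY_le _ _))//.
  have := bY x; rewrite clamp_id// => bx.
  rewrite exprS (le_trans (ler_wpM2l q0 bx))//.
  have -> : 2^-1 * 2^-1 ^+ k * (2 * L) * w x = L * (2^-1 ^+ k * w x).
    by field.
  by rewrite ler_wpM2r ?mulr_ge0 ?exprn_ge0 ?lerDl// ltW.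
pose E := w b.
have E0 : 0 < E by exact: w_gt0.
have YE k t : `|Y k t| <= E * 2^-1 ^+ k.
  rewrite (le_trans ((HY k).2 t))// mulrC ler_wpM2r ?exprn_ge0// w_le//.
  by have /andP[] := cl t.
pose S m t := \sum_(k < m) Y k t.
(* The right side is the sum of [E 2^-k] for [k] from [m] to [m + d - 1]. *)
have SB m d t : `|S (m + d)%N t - S m t| <= 2 * E * 2^-1 ^+ m - 2 * E * 2^-1 ^+ (m + d).
  elim: d => [|d IH]; first by rewrite addn0 !subrr normr0.
  rewrite addnS /S big_ord_recr/= -/(S _ _) addrAC.
  rewrite (le_trans (ler_normD _ _))// (le_trans (lerD IH (YE _ _)))//.
  by rewrite le_eqVlt; apply/orP; left; apply/eqP; rewrite exprS; field.
have Scvg t i j : cvgn (fun m => S m t i j).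
  have -> : (fun m => S m t i j) = series (fun k => Y k t i j).
    by apply/funext => m; rewrite /series/= /S summxE big_mkord.
  have h1 : `|2^-1 : R| < 1 by rewrite ger0_norm ?invr_ge0// invf_lt1// ltr1n.
  apply: normed_cvg; apply: (series_le_cvg _ _ _ (@is_cvg_geometric_series R E _ h1)) => k /=.
  - exact: normr_ge0.
  - by rewrite mulr_ge0 ?exprn_ge0// ltW.
  - by rewrite (le_trans (mx_entry_le _ _ _)).
pose Yl t : 'M[R]_n := \matrix_(i, j) limn (fun m => S m t i j).
have tail m t : `|Yl t - S m t| <= 2 * E * 2^-1 ^+ m.
  apply: mx_norm_le => [|i j]; first by rewrite mulr_ge0 ?exprn_ge0// mulr_ge0// ltW.
  rewrite !mxE.
  have cv : (fun d => `|S d t i j - S m t i j|) @ \oo -->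
      `|limn (fun d => S d t i j) - S m t i j|.
    by apply: cvg_norm; apply: cvgB; [exact: Scvg|exact: cvg_cst].
  apply: (cvgr_to_le cv); exists m => // d /= /subnKC <-.
  have := mx_entry_le (S (m + (d - m))%N t - S m t) i j; rewrite !mxE => /le_trans; apply.
  rewrite (le_trans (SB _ _ _))// gerBl.
  by rewrite mulr_ge0 ?exprn_ge0// mulr_ge0// ltW.
have cS m : continuous (S m).
  by move=> t; apply: cvg_big => // [[x y]|k _]; [exact: add_continuous|exact: (HY k).1].
have cYl : continuous Yl.
  move=> t; apply/cvgrPdist_le => e e0.
  have e3 : 0 < e / 3 by rewrite divr_gt0.
  have /cvgrPdist_le/(_ _ e3)[m _ /(_ _ (leqnn m))/=] := cvg_geometric_half (2 * E).
  rewrite sub0r normrN ger0_norm; last by rewrite mulr_ge0 ?exprn_ge0// mulr_ge0// ltW.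
  move=> me; near=> s.
  have -> : Yl t - Yl s = (Yl t - S m t) + (S m t - S m s) - (Yl s - S m s).
    by rewrite addrA subrK opprB addrA subrK.
  have -> : e = e / 3 + e / 3 + e / 3 by field.
  rewrite (le_trans (ler_normB _ _))// lerD//; last exact: le_trans (tail _ _) me.
  rewrite (le_trans (ler_normD _ _))// lerD//; first exact: le_trans (tail _ _) me.
  by near: s; have /cvgrPdist_le/(_ _ e3) := @cS m t.
have Yl_le t : `|Yl t| <= 2 * E.
  by have := tail 0 t; rewrite /S big_ord0 subr0 expr0 mulr1.
pose F s := B' s *m Yl s.
have cF : continuous F by move=> t; apply: continuous_mulmx; [exact: cB'|exact: cYl].
have bF s : `|F s| <= q * (2 * E).
  by rewrite (le_trans (BY_le _ _))// ler_wpM2l.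
have dF := mx_primitive_derive a cF bF.
(* Unlike [Yl], [Z] is not clamped, so it has two-sided derivatives at [a] and [b] as well. *)
pose Z t := 1%:M + mx_primitive a F t.
have YZ t : Yl t = Z (clamp a b t).
  (* [Z - S m.+1] is the primitive of [B' (Yl - S m)], of size at most [2 q E 2^-m]; letting [m]
     grow identifies [Yl] with [Z] on [[a, b]]. *)
  have key m : `|Z (clamp a b t) - S m.+1 t| <= q * (2 * E) * (b - a) * 2^-1 ^+ m.
    rewrite /Z /S big_ord_recl/= opprD addrACA subrr add0r.
    pose Fk k s := B' s *m Y k s.
    have dFk k (x : R) : is_derive x 1 (mx_primitive a (Fk k)) (Fk k x).
      apply: (@mx_primitive_derive _ _ _ _ _ (q * (E * 2^-1 ^+ k))).
        by move=> s; apply: continuous_mulmx; [exact: cB'|exact: (HY k).1].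
      by move=> s; rewrite (le_trans (BY_le _ _))// ler_wpM2l.
    pose H x := mx_primitive a F x - \sum_(k < m) mx_primitive a (Fk k) x.
    have dH (x : R) : is_derive x 1 H (F x - \sum_(k < m) Fk k x).
      have := is_deriveB (dF x)
        (is_derive_sum (h := fun k : 'I_m => mx_primitive a (Fk k)) (fun k => dFk k x)).
      by congr (is_derive _ _ _ _); apply/funext => s; rewrite /H fctE fct_sumE.
    have /andP[acl clb] := cl t.
    pose c := q * (2 * E) * 2^-1 ^+ m.
    have dc (x : R) : is_derive x 1 (fun x : R => c * x) c.
      by have := is_deriveZ c (is_derive_id x (1 : R)); rewrite /GRing.scale/= mulr1.
    have := @mx_comparison R n n H _ (fun x => c * x) _ a b a (clamp a b t)
      (fun x _ => dH x) (fun x _ => dc x) _ (lexx a) acl clb.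
    rewrite {2}/H mx_primitive0 sub0r big1; last by move=> k _; rewrite mx_primitive0.
    rewrite oppr0 subr0 => K; apply: (le_trans (K _)).
      move=> x _; rewrite /F /Fk -mulmx_sumr -mulmxBr (le_trans (BY_le _ _))//.
      by rewrite /c -mulrA ler_wpM2l// tail.
    rewrite -mulrBr /c [leRHS]mulrAC ler_wpM2l ?lerB//.
    by rewrite !mulr_ge0 ?exprn_ge0// ltW.
  apply/matrixP => i j.
  have c1 : (fun m => S m.+1 t i j) @ \oo --> Yl t i j.
    rewrite mxE; have := Scvg t i j.
    by rewrite -(cvg_shiftS (fun m => S m t i j)).
  have c2 : (fun m => S m.+1 t i j) @ \oo --> Z (clamp a b t) i j.
    apply/cvgrPdist_le => e e0.
    have /cvgrPdist_le/(_ _ e0) := cvg_geometric_half (q * (2 * E) * (b - a)).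
    apply: filterS => m; rewrite sub0r normrN => He.
    have := mx_entry_le (Z (clamp a b t) - S m.+1 t) i j; rewrite !mxE.
    by move=> /le_trans; apply; rewrite (le_trans (key m))// (le_trans (ler_norm _)).
  exact: (cvg_unique _ c1 c2).
exists Z; split; first by rewrite /Z mx_primitive0 addr0.
move=> t tab; have := is_deriveD (is_derive_cst 1%:M t 1) (dF t).
by rewrite add0r /F YZ /B'/= clamp_id.
Unshelve. all: by end_near. Qed.
End linear_ode.

(** * Integrals of bounded measurable functions *)

Definition bounded_measurable {R : realType} (g : R -> R) :=
  measurable_fun [set: R] g /\ exists K, forall t, `|g t| <= K.

Section bounded_measurable.
Context {R : realType}.
Implicit Types g h : R -> R.

Lemma bounded_measurableD g h : bounded_measurable g -> bounded_measurable h ->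
  bounded_measurable (fun t => g t + h t).
Proof.
move=> [mg [K gK]] [mh [L hL]]; split; first exact: measurable_funD.
by exists (K + L) => t; rewrite (le_trans (ler_normD _ _))// lerD.
Qed.

Lemma bounded_measurableM g h : bounded_measurable g -> bounded_measurable h ->
  bounded_measurable (fun t => g t * h t).
Proof.
move=> [mg [K gK]] [mh [L hL]]; split; first exact: measurable_funM.
by exists (K * L) => t; rewrite normrM ler_pM.
Qed.

Lemma bounded_measurable_cst (c : R) : bounded_measurable (fun=> c).
Proof. by split; [exact: measurable_cst|exists `|c|]. Qed.

Lemma bounded_measurable_sum n (h : 'I_n -> R -> R) :
  (forall k, bounded_measurable (h k)) ->
  bounded_measurable (fun t => \sum_k h k t).
Proof.
move=> H; split; first by apply: measurable_sum => k; have [] := H k.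
have /choice[K hK] k : exists K, forall t, `|h k t| <= K by have [] := H k.
exists (\sum_k K k) => t; rewrite (le_trans (ler_norm_sum _ _ _))//.
by apply: ler_sum => k _; exact: hK.
Qed.

Lemma bounded_measurable_lip g (phi : R -> R) (L : R) :
  (forall x y, `|phi x - phi y| <= L * `|x - y|) ->
  bounded_measurable g -> bounded_measurable (fun t => phi (g t)).
Proof.
move=> H [mg [K gK]]; split.
  apply: (@measurableT_comp _ _ _ _ _ _ phi) => //.
  apply: continuous_measurable_fun; apply: (@lipschitz_continuous _ _ _ _ L) => s t.
  exact: H.
exists (`|L| * K + `|phi 0|) => t.
have -> : phi (g t) = (phi (g t) - phi 0) + phi 0 by rewrite subrK.
rewrite (le_trans (ler_normD _ _))// lerD2r (le_trans (H _ _))// subr0.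
by rewrite (le_trans (ler_wpM2r _ (ler_norm L)))// ler_wpM2l.
Qed.

Lemma bounded_measurable_continuous g K : continuous g ->
  (forall t, `|g t| <= K) -> bounded_measurable g.
Proof. by move=> cg gK; split; [exact: continuous_measurable_fun|exists K]. Qed.

End bounded_measurable.

Section integral.
Context {R : realType} (a b : R).
Hypothesis ab : a <= b.
Local Notation mu := (@lebesgue_measure R).
Local Notation I g := (\int[lebesgue_measure]_(t in `[a, b]) g t).
Implicit Types g h : R -> R.

Lemma bounded_measurable_integrable g : bounded_measurable g ->
  mu.-integrable `[a, b] (EFin \o g).
Proof. by move=> [mg [K gK]]; exact: itv_integrable_bounded mg gK _ _. Qed.

Lemma integralD_bm g h : bounded_measurable g -> bounded_measurable h ->
  I (fun t => g t + h t) = I g + I h.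
Proof.
by move=> bg bh; rewrite RintegralD//; exact: bounded_measurable_integrable.
Qed.

Lemma integralZ_bm g (c : R) : bounded_measurable g ->
  I (fun t => c * g t) = c * I g.
Proof.
by move=> bg; rewrite RintegralZl//; exact: bounded_measurable_integrable.
Qed.

Lemma integral_cst_bm (c : R) : I (fun=> c) = c * (b - a).
Proof.
rewrite Rintegral_cst//= lebesgue_measure_itv/= lte_fin.
by case: ltP => // ba; rewrite (@le_anti _ _ a b) ?ab// subrr.
Qed.

Lemma le_integral_bm g h : bounded_measurable g -> bounded_measurable h ->
  (forall t, t \in `[a, b] -> g t <= h t) -> I g <= I h.
Proof.
move=> /bounded_measurable_integrable ig /bounded_measurable_integrable ih H.
by apply: (le_Rintegral _ ig ih) => // t; exact: H.
Qed.

Lemma integral_bm_eq0 g : bounded_measurable g ->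
  (forall t, 0 <= g t) -> I g = 0 ->
  {ae lebesgue_measure, forall t : R, t \in `[a, b] -> g t = 0}.
Proof.
move=> bg g0 I0.
have ig := bounded_measurable_integrable bg.
have E0 : (\int[mu]_(t in `[a, b]) `|(EFin \o g) t| = 0)%E.
  under eq_integral do rewrite /= ger0_norm//.
  have : (\int[mu]_(t in `[a, b]) (EFin \o g) t \is a fin_num)%E.
    exact: integrable_fin_num.
  by move=> /fineK <-; congr EFin.
have mg : measurable_fun `[a, b] (EFin \o g).
  by apply/measurable_EFinP; apply: measurable_funTS; have [] := bg.
have := (ae_eq_integral_abs mu (measurable_itv `[a, b]) mg).1 E0.
apply: lebesgue_aeS => t /= H tab.
by have := H tab => -[].
Qed.

End integral.

(** * Minimum-norm alternative *)

Section smoothed_abs.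
Context {R : realType}.
Implicit Types x y : R.

(** A smooth majorant of the absolute value. Its derivative [x / sabs x] is increasing and stays
    strictly between -1 and 1, which is the source of [rho < 1]. *)
Definition sabs x := Num.sqrt (1 + x ^+ 2).

Lemma sabs_sqr x : sabs x ^+ 2 = 1 + x ^+ 2.
Proof. by rewrite sqr_sqrtr// addr_ge0// sqr_ge0. Qed.

Lemma sabs_ge1 x : 1 <= sabs x.
Proof. by rewrite -[leLHS]sqrtr1 ler_wsqrtr// lerDl sqr_ge0. Qed.

Lemma sabs_gt0 x : 0 < sabs x.
Proof. exact: lt_le_trans (sabs_ge1 x). Qed.

Lemma sabs_ge0 x : 0 <= sabs x.
Proof. exact: sqrtr_ge0. Qed.

Lemma sabs_ge_norm x : `|x| <= sabs x.
Proof. by rewrite -sqrtr_sqr ler_wsqrtr// lerDr. Qed.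

Lemma sabs_lip x y : `|sabs x - sabs y| <= 1 * `|x - y|.
Proof.
have s0 : 0 < sabs x + sabs y by rewrite addr_gt0// sabs_gt0.
rewrite mul1r -(ler_pM2r s0) -{1}(gtr0_norm s0) -normrM.
have -> : (sabs x - sabs y) * (sabs x + sabs y) = (x - y) * (x + y).
  by rewrite -!subr_sqr !sabs_sqr; ring.
rewrite normrM ler_wpM2l//.
by rewrite (le_trans (ler_normD _ _))// lerD// sabs_ge_norm.
Qed.

(* the second derivative of sabs is at most 1 *)
Lemma sabs_taylor x y : sabs (x + y) <= sabs x + x / sabs x * y + y ^+ 2 / 2.
Proof.
have s1 := sabs_ge1 x; have s0 := sabs_gt0 x; have ss := sabs_sqr x.
set p := x / sabs x.
have xE : x = p * sabs x by rewrite /p divfK ?gt_eqF.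
have p1 : `|p| <= 1.
  by rewrite /p normrM normfV (gtr0_norm s0) ler_pdivrMr// mul1r sabs_ge_norm.
have /andP[p1l p1r] : -1 <= p <= 1 by rewrite -ler_norml.
have r0 : 0 <= sabs x + p * y + y ^+ 2 / 2.
  have h1 : 0 <= (y + p) ^+ 2 by exact: sqr_ge0.
  have h2 : p ^+ 2 <= 1 by rewrite -[leLHS]real_normK ?num_real// expr_le1.
  have -> : sabs x + p * y + y ^+ 2 / 2 = (sabs x - 1) + ((y + p) ^+ 2 + (2 - p ^+ 2)) / 2 by field.
  lra.
rewrite -(ler_pXn2r (n := 2))// ?nnegrE ?sabs_ge0// sabs_sqr.
have -> : 1 + (x + y) ^+ 2 = sabs x ^+ 2 + 2 * (p * sabs x) * y + y ^+ 2.
  by rewrite ss -xE; ring.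
(* After squaring, the right side exceeds the left by [y ^+ 2 * (sabs x - 1)] plus this square. *)
have h : 0 <= (p * y + y ^+ 2 / 2) ^+ 2 by exact: sqr_ge0.
have h2 : y ^+ 2 <= y ^+ 2 * sabs x by rewrite ler_peMr// sqr_ge0.
have -> : (sabs x + p * y + y ^+ 2 / 2) ^+ 2 = sabs x ^+ 2 + 2 * (p * sabs x) * y
    + y ^+ 2 * sabs x + (p * y + y ^+ 2 / 2) ^+ 2 by field.
lra.
Qed.

(** Squaring reduces the claim to [x ^+ 2 * (1 + y ^+ 2) <= y ^+ 2 * (1 + x ^+ 2)], that is,
    [x ^+ 2 <= y ^+ 2]. *)
Lemma sabs_slope_le x y : `|x| <= y -> `|x / sabs x| <= y / sabs y.
Proof.
move=> xy; have y0 : 0 <= y by exact: le_trans xy.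
rewrite normrM normfV (gtr0_norm (sabs_gt0 x)).
rewrite ler_pdivrMr ?sabs_gt0// mulrAC ler_pdivlMr ?sabs_gt0//.
rewrite -(ler_pXn2r (n := 2))// ?nnegrE ?mulr_ge0 ?sabs_ge0//.
rewrite !exprMn !sabs_sqr real_normK ?num_real//.
have : x ^+ 2 <= y ^+ 2.
  by rewrite -(real_normK (num_real x)) ler_pXn2r ?nnegrE.
lra.
Qed.

Lemma sabs_slope_lt1 y : y / sabs y < 1.
Proof.
rewrite ltr_pdivrMr ?sabs_gt0// mul1r (le_lt_trans (ler_norm _))//.
rewrite -(ltr_pXn2r (n := 2))// ?nnegrE ?sabs_ge0// sabs_sqr.
by rewrite real_normK ?num_real// ltrDr.
Qed.

Lemma sabs_continuous : continuous sabs.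
Proof.
by apply: (@lipschitz_continuous _ R R sabs 1) => s t; exact: sabs_lip.
Qed.

Lemma sabs_slope_continuous : continuous (fun x => x / sabs x).
Proof.
move=> x; apply: cvgM; first exact: cvg_id.
apply: cvgV; first by rewrite gt_eqF// sabs_gt0.
exact: sabs_continuous.
Qed.

End smoothed_abs.

Section minimum_norm_alternative.
Context {R : realType} (n : nat) (a b alpha M : R).
Variables (Y : R -> 'M[R]_n) (u : R -> 'cV[R]_n).
Hypothesis ab : a < b.
Hypothesis alpha0 : 0 < alpha.
Hypothesis cY : continuous Y.
Hypothesis YM : forall t, `|Y t| <= M.
Hypothesis mu_ : forall j, measurable_fun [set: R] (fun t => u t j 0).
Hypothesis ualpha : forall t j, `|u t j 0| <= alpha.

Local Notation I g := (\int[lebesgue_measure]_(t in `[a, b]) g t).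

Let leab : a <= b. Proof. exact: ltW. Qed.

Let l (c : 'rV[R]_n) t j := (c *m Y t) 0 j.

Let l_le c t j : `|l c t j| <= n%:R * M * `|c|.
Proof.
rewrite (le_trans (mx_entry_le _ _ _))// (le_trans (mulmx_norm_le _ _))//.
by rewrite mulrAC ler_wpM2r// ler_wpM2l.
Qed.

Let l_bm c j : bounded_measurable (fun t => l c t j).
Proof.
apply: (@bounded_measurable_continuous _ _ (n%:R * M * `|c|)) => [t|t]; last exact: l_le.
have ct : {for t, continuous (fun t => c *m Y t)}.
  by apply: continuous_mulmx; [exact: cst_continuous|exact: cY].
exact: ((continuous_mxP _ _).1 ct 0 j).
Qed.

Let lB c d t j : l c t j - l d t j = l (c - d) t j.
Proof. by rewrite /l mulmxBl !mxE. Qed.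

Let lD c d t j : l (c + d) t j = l c t j + l d t j.
Proof. by rewrite /l mulmxDl !mxE. Qed.

Let lZ s c t j : l (s *: c) t j = s * l c t j.
Proof. by rewrite /l -scalemxAl !mxE. Qed.

Let u_bm j : bounded_measurable (fun t => u t j 0).
Proof. by split; [exact: mu_|exists alpha]. Qed.

(** With [h] the absolute value this is the integrand of the convex function [F]; with [h = sabs],
    that of its smoothing [G]. *)
Let f h c t := \sum_j (alpha * h (l c t j) + l c t j * u t j 0).

Let f_bm h c : (forall x y, `|h x - h y| <= 1 * `|x - y|) ->
  bounded_measurable (f h c).
Proof.
move=> hlip; apply: bounded_measurable_sum => j.
apply: bounded_measurableD; last exact: bounded_measurableM.
apply: bounded_measurableM; first exact: bounded_measurable_cst.
exact: bounded_measurable_lip hlip (l_bm c j).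
Qed.

Let J_continuous h : (forall x y, `|h x - h y| <= 1 * `|x - y|) ->
  continuous (fun c => I (f h c)).
Proof.
move=> hlip.
(* Each summand has Lipschitz constant [2 alpha] in [l], one [alpha] from [h] and one from the bound
   on [u]; [l] has constant [n M] in [c]. *)
pose C := \sum_(j < n) (2 * alpha * (n%:R * M)) * (b - a).
have H c d : I (f h c) <= I (f h d) + C * `|c - d|.
  pose K := \sum_(j < n) (2 * alpha * (n%:R * M)) * `|c - d|.
  have -> : C * `|c - d| = I (fun=> K).
    rewrite (integral_cst_bm leab) /C /K -!mulr_suml; ring.
  rewrite -integralD_bm; [|exact: f_bm|exact: bounded_measurable_cst].
  apply: le_integral_bm; first exact: f_bm.
    by apply: bounded_measurableD; [exact: f_bm|exact: bounded_measurable_cst].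
  move=> t _; rewrite /f /K -big_split/=; apply: ler_sum => j _.
  have l1 := l_le (c - d) t j; rewrite -lB in l1.
  have h1 := hlip (l c t j) (l d t j); rewrite mul1r in h1.
  set x := l c t j in l1 h1 *; set y := l d t j in l1 h1 *.
  have e1 : alpha * (h x - h y) <= alpha * `|x - y|.
    by rewrite ler_pM2l// (le_trans (ler_norm _)).
  have e2 : (x - y) * u t j 0 <= `|x - y| * alpha.
    by rewrite (le_trans (ler_norm _))// normrM ler_wpM2l.
  have e3 : alpha * `|x - y| <= alpha * (n%:R * M * `|c - d|) by rewrite ler_pM2l.
  lra.
apply: (@lipschitz_continuous _ _ _ _ C) => c d.
rewrite ler_norml; have h1 := H c d; have h2 := H d c.
by rewrite distrC in h1; apply/andP; split; lra.
Qed.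

Let abs_lip (x y : R) : `| `|x| - `|y| | <= 1 * `|x - y|.
Proof. by rewrite mul1r ler_dist_dist. Qed.

Let fabs_ge0 c t j : 0 <= alpha * `|l c t j| + l c t j * u t j 0.
Proof.
have : `|l c t j * u t j 0| <= `|l c t j| * alpha by rewrite normrM ler_wpM2l.
by rewrite ler_norml => /andP[]; lra.
Qed.

(* If no c <> 0 gives equality, the convex function c |-> I (f sabs c) is coercive;
   the stationarity condition at its minimum produces w. *)
Lemma minimum_norm_alternative :
  (exists c : 'rV[R]_n, c != 0 /\
     {ae lebesgue_measure, forall t : R, t \in `[a, b] ->
        forall j, alpha * `|(c *m Y t) 0 j| + (c *m Y t) 0 j * u t j 0 = 0}) \/
  (exists (w : R -> 'cV[R]_n) (rho : R),
     [/\ continuous w, rho < 1, (forall t j, `|w t j 0| <= rho) &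
       forall k, I (fun t => \sum_j Y t k j * (alpha * w t j 0 - u t j 0)) = 0]).
Proof.
pose F c := I (f (fun x => `|x|) c); pose G c := I (f sabs c).
have F_ge0 c : 0 <= F c.
  by apply: Rintegral_ge0 => t _; apply: sumr_ge0 => j _; exact: fabs_ge0.
have [[c [c0 Fc]]|Fn0] := pselect (exists c, c != 0 /\ F c = 0).
  left; exists c; split => //.
  have := integral_bm_eq0 (f_bm c abs_lip) _ Fc.
  have f0 t : 0 <= f (fun x => `|x|) c t by apply: sumr_ge0 => j _; exact: fabs_ge0.
  move=> /(_ f0); apply: lebesgue_aeS => t H tab j.
  have /psumr_eq0P : \sum_j (alpha * `|l c t j| + l c t j * u t j 0) = 0 := H tab.
  by move=> /(_ (fun j _ => fabs_ge0 c t j)); apply.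
right.
have F_gt0 c : c != 0 -> 0 < F c.
  by move=> c0; rewrite lt_neqAle F_ge0 andbT eq_sym; apply/eqP => Fc; apply: Fn0; exists c.
have FZ s c : 0 <= s -> F (s *: c) = s * F c.
  move=> s0; rewrite /F -integralZ_bm; last exact: f_bm.
  congr (Rintegral _ _ _); apply/funext => t; rewrite /f mulr_sumr.
  by apply: eq_bigr => j _; rewrite lZ normrM ger0_norm//; ring.
have cF : continuous F := J_continuous abs_lip.
have cG : continuous G := J_continuous sabs_lip.
have compact_ball r : compact [set c : 'rV[R]_n | `|c| <= r].
  apply: bounded_closed_compact.
    by exists r; split; [exact: num_real|move=> x rx c /= cr; exact: le_trans (ltW rx)].
  have := @closed_comp _ _ (fun c : 'rV[R]_n => `|c|) [set x | x <= r].
  by apply => [c _|]; [exact: norm_continuous|exact: closed_le].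
(* [kappa] is the minimum of [F] on the unit sphere; homogeneity carries the bound to every [c]. *)
have [kappa kappa0 Fk] : exists2 kappa, 0 < kappa & forall c, kappa * `|c| <= F c.
  pose sphere := [set c : 'rV[R]_n | `|c| = 1].
  (* The sphere is empty only when [n = 0]; then every [c] is 0 and any [kappa] serves. *)
  have [[c0 c01]|sphere0] := pselect (sphere !=set0); last first.
    exists 1 => // c; have [->|cn0] := eqVneq c 0; first by rewrite normr0 mulr0.
    exfalso; apply: sphere0; exists (`|c|^-1 *: c).
    by rewrite /sphere/= normrZ normfV normr_id mulVf// normr_eq0.
  have csphere : compact sphere.
    apply: (@subclosed_compact _ _ [set c : 'rV[R]_n | `|c| <= 1]) => //.
      have := @closed_comp _ _ (fun c : 'rV[R]_n => `|c|) [set x | x = 1].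
      by apply => [c _|]; [exact: norm_continuous|exact: closed_eq].
    by move=> c /= ->.
  have [||c] := @EVT_min_rV _ _ F sphere _ csphere _.
  - by exists c0.
  - exact: continuous_subspaceT.
  rewrite inE => c1 Hc; exists (F c).
    by apply: F_gt0; rewrite -normr_eq0 c1 oner_eq0.
  move=> d; have [->|dn0] := eqVneq d 0; first by rewrite normr0 mulr0.
  have d0 : 0 < `|d| by rewrite normr_gt0.
  rewrite mulrC -ler_pdivlMl// -FZ ?invr_ge0//.
  by apply: Hc; rewrite inE /sphere/= normrZ normfV normr_id mulVf// normr_eq0.
have FG c : F c <= G c.
  apply: le_integral_bm; [exact: f_bm abs_lip|exact: f_bm sabs_lip|].
  move=> t _; apply: ler_sum => j _; rewrite lerD2r ler_pM2l//.
  exact: sabs_ge_norm.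
have [c Gmin] : exists c, forall d, G c <= G d.
  (* Outside this ball [G d >= kappa |d| > G 0], so the minimum over the ball is global. *)
  pose r := G 0 / kappa.
  have r0 : 0 <= r := divr_ge0 (le_trans (F_ge0 0) (FG 0)) (ltW kappa0).
  have [||c] := @EVT_min_rV _ _ G [set c | `|c| <= r] _ (compact_ball r) _.
  - by exists 0; rewrite /= normr0.
  - exact: continuous_subspaceT.
  rewrite inE /= => cr Hc; exists c => d.
  have [dr|rd] := leP `|d| r; first by apply: Hc; rewrite inE.
  apply: le_trans (FG d); apply: le_trans (Fk d).
  apply: (@le_trans _ _ (G 0)); first by apply: Hc; rewrite inE /= normr0.
  by rewrite mulrC -ler_pdivrMr// ltW.
pose p t j := l c t j / sabs (l c t j).
have p_le t j : `|p t j| <= 1.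
  by rewrite (le_trans (sabs_slope_le (lexx _)))// ltW// sabs_slope_lt1.
have p_bm j : bounded_measurable (fun t => p t j).
  split; last by exists 1.
  have [ml _] := l_bm c j.
  apply: (@measurableT_comp _ _ _ _ _ _ (fun x : R => x / sabs x)) => //.
  apply: continuous_measurable_fun; exact: sabs_slope_continuous.
(* The integral of [g e] is the directional derivative of [G] at the minimizer [c] along [e]. *)
pose g e t := \sum_j (alpha * p t j + u t j 0) * l e t j.
have g_bm e : bounded_measurable (g e).
  apply: bounded_measurable_sum => j; apply: bounded_measurableM => //.
  apply: bounded_measurableD => //; apply: bounded_measurableM => //.
  exact: bounded_measurable_cst.
have g0 e : I (g e) = 0.
  pose C := \sum_(j < n) alpha * (n%:R * M * `|e|) ^+ 2 / 2 * (b - a).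
  have C0 : 0 <= C.
    apply: sumr_ge0 => j _; have al0 := ltW alpha0.
    by rewrite mulr_ge0 ?subr_ge0// mulr_ge0 ?invr_ge0// mulr_ge0// sqr_ge0.
  (* Minimality of [c] is combined with the quadratic upper bound for [G (c + s *: e)] given by
     [sabs_taylor]. *)
  have H s : 0 <= s * I (g e) + C * s ^+ 2.
    have := Gmin (c + s *: e).
    suff : G (c + s *: e) <= G c + (s * I (g e) + C * s ^+ 2) by lra.
    pose K := \sum_(j < n) alpha * (n%:R * M * `|e|) ^+ 2 / 2 * s ^+ 2.
    have -> : C * s ^+ 2 = I (fun=> K).
      rewrite (integral_cst_bm leab) /C /K -!mulr_suml; ring.
    have bK : bounded_measurable (fun=> K) := bounded_measurable_cst K.
    have bs := bounded_measurableM (bounded_measurable_cst s) (g_bm e).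
    have bG c' : bounded_measurable (f sabs c') := f_bm c' sabs_lip.
    rewrite -integralZ_bm// -(integralD_bm a b bs bK).
    rewrite -(integralD_bm a b (bG c) (bounded_measurableD bs bK)).
    apply: (@le_integral_bm _ a b _ _ (bG _)
      (bounded_measurableD (bG c) (bounded_measurableD bs bK))).
    move=> t _; rewrite /f /g /K mulr_sumr -!big_split/=; apply: ler_sum => j _.
    rewrite lD lZ.
    have h1 := sabs_taylor (l c t j) (s * l e t j).
    have h2 : (l e t j) ^+ 2 <= (n%:R * M * `|e|) ^+ 2.
      have h3 := l_le e t j.
      by rewrite -(real_normK (num_real (l e t j))) ler_pXn2r ?nnegrE// (le_trans _ h3).
    have {}h1 := ler_wpM2l (ltW alpha0) h1.
    have {}h2 : s ^+ 2 * (l e t j) ^+ 2 <= s ^+ 2 * (n%:R * M * `|e|) ^+ 2.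
      by rewrite ler_wpM2l// sqr_ge0.
    have {}h2 := ler_wpM2l (ltW alpha0) h2.
    rewrite /p; lra.
  apply/eqP; apply: contraT => /eqP I0.
  set i := I (g e) in H I0.
  have C1 : 0 < C + 1 by rewrite ltr_wpDl.
  (* At this [s] the quadratic equals [- (i / (C + 1)) ^+ 2], negative unless [i = 0]. *)
  have := H (- i / (C + 1)).
  have -> : - i / (C + 1) * i + C * (- i / (C + 1)) ^+ 2
      = - (i / (C + 1)) ^+ 2 by field; rewrite gt_eqF.
  rewrite oppr_ge0 => h.
  have : (i / (C + 1)) ^+ 2 == 0 by rewrite eq_le h sqr_ge0.
  by rewrite sqrf_eq0 mulf_eq0 invr_eq0 (gt_eqF C1) orbF => /eqP /I0.
pose w t : 'cV[R]_n := \col_j - p t j.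
have cl j : continuous (fun t => l c t j).
  move=> t; have ct : {for t, continuous (fun t => c *m Y t)}.
    by apply: continuous_mulmx; [exact: cst_continuous|exact: cY].
  exact: ((continuous_mxP _ _).1 ct 0 j).
(* [Lam] bounds [|l c t j|] for all [t] and [j]; monotonicity of the slope turns it into a single
   [rho < 1]. *)
pose Lam := n%:R * M * `|c|.
exists w, (Lam / sabs Lam); split.
- move=> t; apply/continuous_mxP => j k.
  have -> : (fun s => w s j k) = (fun s => - p s j) by apply/funext => s; rewrite mxE.
  apply: cvgN; apply: (@continuous_comp _ _ _ (fun t => l c t j) (fun x => x / sabs x)).
    exact: cl.
  exact: sabs_slope_continuous.
- exact: sabs_slope_lt1.
- by move=> t j; rewrite mxE normrN; apply: sabs_slope_le; exact: l_le.
(* The direction [- delta_mx 0 k] extracts row [k] of [Y], with the sign that matches [w = - p]. *)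
- move=> k; have := g0 (- delta_mx 0 k).
  congr (_ = _); congr (Rintegral _ _ _); apply/funext => t.
  apply: eq_bigr => j _.
  have -> : l (- delta_mx 0 k) t j = - Y t k j by rewrite /l mulNmx -rowE !mxE.
  by rewrite mxE; ring.
Qed.

End minimum_norm_alternative.

(** * Alternative on one stage *)

Section fundamental_pair.
Context {R : realType} (n : nat) (A : R -> 'M[R]_n) (a b : R).
Hypothesis ab : a <= b.
Hypothesis cA : {within `[a, b], continuous A}.

Lemma mx_constant m p (P : R -> 'M[R]_(m, p)) (t : R) :
  (forall s : R, s \in `[a, b] -> is_derive s 1 P 0) -> t \in `[a, b] -> P t = P a.
Proof.
move=> dP tab; have /andP[at_ tb] : a <= t <= b by rewrite in_itv in tab.
have d0 s : s \in `[a, b] -> is_derive s (1 : R) (fun=> 0 : R) ((fun=> 0) s).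
  by move=> _; exact: is_derive_cst.
have le0 s : s \in `[a, b] -> `|0 : 'M[R]_(m, p)| <= (fun=> 0) s by rewrite normr0.
have := mx_comparison dP d0 le0 (lexx a) at_ tb.
by rewrite subrr normr_le0 subr_eq0 => /eqP.
Qed.

(** [Y] is the transpose of a solution of [Z' = - A^T Z]. The product [Y X] has zero derivative and
    is the identity at [a], so [Y] inverts [X] throughout. *)
Lemma fundamental_pair : exists X Y : R -> 'M[R]_n,
  [/\ forall t : R, t \in `[a, b] -> is_derive t 1 X (A t *m X t),
      forall t : R, t \in `[a, b] -> is_derive t 1 Y (- (Y t *m A t)) &
      forall t : R, t \in `[a, b] -> Y t *m X t = 1%:M].
Proof.
have [X [X0 dX]] := linear_ode ab cA.
have cA' : {within `[a, b], continuous (fun t => - (A t)^T)}.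
  move=> t; apply/continuous_mxP => i j.
  have -> : (fun s => (- (A s)^T) i j) = (fun s => - A s j i).
    by apply/funext => s; rewrite !mxE.
  have cji := (@continuous_mxP R (subspace `[a, b]%classic) n n A t).1 (@cA t) j i.
  exact: (cvgN cji).
have [Z [Z0 dZ]] := linear_ode ab cA'.
have dY (t : R) : t \in `[a, b] ->
    is_derive t 1 (fun s => (Z s)^T) (- ((Z t)^T *m A t)).
  move=> tab; apply: (is_derive_eq (is_derive_trmx (dZ t tab))).
  by rewrite mulNmx linearN/= trmx_mul trmxK.
exists X, (fun t => (Z t)^T); split => // t tab.
have := @mx_constant n n (fun t => (Z t)^T *m X t) t _ tab.
rewrite X0 Z0 trmx1 mulmx1; apply => s sab.
apply: (is_derive_eq (is_derive_mulmx (dY s sab) (dX s sab))).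
by rewrite mulNmx mulmxA addNr.
Qed.

End fundamental_pair.

Section lipschitz.
Context {R : realType}.

Lemma lipschitz_itv (V : normedModType R) (f : R -> V) (K a b : R) :
  a <= b -> 0 <= K ->
  (forall s t, a <= s -> s <= t -> t <= b -> `|f t - f s| <= K * (t - s)) ->
  forall s t, `|f (clamp a b t) - f (clamp a b s)| <= K * `|t - s|.
Proof.
move=> ab K0 H s t; wlog st : s t / s <= t.
  move=> W; have [/W//|/ltW ts] := leP s t.
  by rewrite [leLHS]distrC [`|t - s|]distrC; exact: W.
have /andP[c0 cl] := clamp_lip a b st.
have := clamp_itv s ab; have := clamp_itv t ab; rewrite !in_itv/= => /andP[_ h1] /andP[h2 _].
rewrite (le_trans (H _ _ h2 _ h1)) ?subr_ge0//; first by rewrite -subr_ge0.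
by rewrite ler_wpM2l// (le_trans cl)// ler_norm.
Qed.

Lemma lipschitz_mulmx n m p (A : R -> 'M[R]_(n, m)) (B : R -> 'M[R]_(m, p)) (K L C D : R) :
  (forall s t, `|A t - A s| <= K * `|t - s|) ->
  (forall s t, `|B t - B s| <= L * `|t - s|) ->
  (forall t, `|A t| <= C) -> (forall t, `|B t| <= D) ->
  forall s t, `|A t *m B t - A s *m B s| <= m%:R * (K * D + C * L) * `|t - s|.
Proof.
move=> HA HB AC BD s t.
have -> : A t *m B t - A s *m B s = (A t - A s) *m B t + A s *m (B t - B s).
  by rewrite mulmxBl mulmxBr addrA subrK.
rewrite (le_trans (ler_normD _ _))// mulrDr mulrDl lerD//.
  rewrite (le_trans (mulmx_norm_le _ _))// -!mulrA ler_wpM2l//.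
  by rewrite (mulrC D) mulrA ler_pM.
rewrite (le_trans (mulmx_norm_le _ _))// -!mulrA ler_wpM2l//.
by rewrite ler_pM.
Qed.

End lipschitz.

Lemma lebesgue_ae_forall {R : realType} (I : finType) (P : I -> R -> Prop) :
  (forall i, {ae lebesgue_measure, forall t, P i t}) ->
  {ae lebesgue_measure, forall t, forall i, P i t}.
Proof.
by apply: filter_forall; exact: (ae_filter_ringOfSetsType lebesgue_measure).
Qed.

Section stage_alternative.
Context {R : realType} (n : nat) (A : R -> 'M[R]_n) (a b alpha : R).
Variable u : R -> 'cV[R]_n.
Hypothesis ab : a < b.
Hypothesis cA : {within `[a, b], continuous A}.
Hypothesis alpha0 : 0 < alpha.
Hypothesis mu_ : forall j, measurable_fun [set: R] (fun t => u t j 0).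
Hypothesis ualpha : forall t j, `|u t j 0| <= alpha.

(** In the first case [l = c Y]. The second is variation of constants: [d = X D], with [D] the
    primitive of [Y (alpha w - u)]; the integral condition on [w] makes [D] vanish at [b] as well as
    at [a]. *)
Lemma stage_alternative :
  (exists l : R -> 'rV[R]_n,
     (forall t : R, t \in `[a, b] -> is_derive t 1 l (- (l t *m A t)) /\ l t != 0) /\
     {ae lebesgue_measure, forall t : R, t \in `[a, b] ->
        forall j, alpha * `|l t 0 j| + l t 0 j * u t j 0 = 0}) \/
  (exists (d w : R -> 'cV[R]_n) (rho L : R),
     [/\ rho < 1 /\ (forall s t, `|d t - d s| <= L * `|t - s|),
         forall t, t <= a \/ b <= t -> d t = 0,
         continuous w, forall t j, `|w t j 0| <= rho &
         {ae lebesgue_measure, forall t : R, t \in `[a, b] ->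
            is_derive t 1 d (A t *m d t + (alpha *: w t - u t))}]).
Proof.
have leab := ltW ab.
have [X [Y [dX dY YX]]] := fundamental_pair leab cA.
have cY : {within `[a, b], continuous Y}.
  by apply: derivable_within_continuous => t /dY[].
have cX : {within `[a, b], continuous X}.
  by apply: derivable_within_continuous => t /dX[].
have [M _ YM] := clamp_bounded leab cY.
have cYc : continuous (fun t => Y (clamp a b t)) := continuous_clamp leab cY.
have [[c [c0 Hc]]|[w [rho [cw rho1 wrho Hw]]]] :=
  minimum_norm_alternative ab alpha0 cYc YM mu_ ualpha.
  left; exists (fun t => c *m Y t); split.
    move=> t tab; split; last first.
      apply: contra c0 => /eqP cY0.
      by rewrite -[c]mulmx1 -(YX t tab) mulmxA cY0 mul0mx.
    apply: (is_derive_eq (is_derive_mulmx (is_derive_cst c t 1) (dY t tab))).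
    by rewrite mul0mx add0r mulmxN mulmxA.
  apply: lebesgue_aeS Hc => t H tab j.
  by have := H tab j; rewrite clamp_id.
right.
pose v t := alpha *: w t - u t.
pose g k t := \sum_j Y (clamp a b t) k j * (alpha * w t j 0 - u t j 0).
have g_bm k : bounded_measurable (g k).
  apply: bounded_measurable_sum => j; apply: bounded_measurableM.
    apply: (@bounded_measurable_continuous _ _ M) => [|t].
      by move=> t; exact: ((continuous_mxP _ _).1 (cYc t) k j).
    exact: le_trans (mx_entry_le _ _ _) (YM t).
  apply: bounded_measurableD.
    apply: bounded_measurableM; first exact: bounded_measurable_cst.
    apply: (@bounded_measurable_continuous _ _ rho) => // t.
    exact: ((continuous_mxP _ _).1 (cw t) j 0).
  split; first by apply: measurableT_comp => //; exact: mu_.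
  by exists alpha => t; rewrite normrN.
have /choice[K0 HK0] k : exists K, forall t, `|g k t| <= K by have [] := g_bm k.
pose K := \sum_k `|K0 k|.
have gK k t : `|g k t| <= K.
  rewrite (le_trans (HK0 k t))// (le_trans (ler_norm _))//.
  by rewrite /K (bigD1 k)//= lerDl sumr_ge0.
have K_ge0 : 0 <= K by apply: sumr_ge0.
pose D t : 'cV[R]_n := \col_k primitive a (g k) t.
have Dlip s t : a <= s -> s <= t -> t <= b -> `|D t - D s| <= K * (t - s).
  move=> _ st _; apply: mx_norm_le => [|k j]; first by rewrite mulr_ge0 ?subr_ge0.
  have [_ H _ _ _] := primitiveP a (g_bm k).1 (gK k).
  by rewrite !mxE; exact: H.
have Da : D a = 0 by apply/matrixP => k j; rewrite !mxE /primitive subrr.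
have Db : D b = 0.
  apply/matrixP => k j; rewrite !mxE.
  have [_ _ _ _ ->//] := primitiveP a (g_bm k).1 (gK k).
  exact: Hw.
have dD : {ae lebesgue_measure, forall t : R,
    is_derive t 1 D (Y (clamp a b t) *m v t)}.
  have : {ae lebesgue_measure, forall t : R, forall k,
      is_derive t 1 (primitive a (g k)) (g k t)}.
    apply: lebesgue_ae_forall => k.
    by have [] := primitiveP a (g_bm k).1 (gK k).
  apply: lebesgue_aeS => t H; apply/is_derive_mxP => k j.
  under [X in is_derive _ _ X _]eq_fun do rewrite mxE.
  apply: (is_derive_eq (H k)); rewrite mxE; apply: eq_bigr => i _.
  by rewrite /v !mxE (ord1 j).
have [CA CA0 HA] := clamp_bounded leab cA.
have [CX CX0 HX] := clamp_bounded leab cX.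
have cD : {within `[a, b], continuous D}.
  apply: continuous_subspaceT.
  have Dlip' : forall s t : R, `|D t - D s| <= K * `|t - s|.
    move=> s t; wlog st : s t / s <= t.
      move=> W; have [/W//|/ltW ts] := leP s t.
      by rewrite [leLHS]distrC [`|t - s|]distrC; exact: W.
    rewrite (ger0_norm (_ : 0 <= t - s)) ?subr_ge0//.
    apply: mx_norm_le => [|k j]; first by rewrite mulr_ge0 ?subr_ge0.
    have [_ H _ _ _] := primitiveP a (g_bm k).1 (gK k).
    by rewrite !mxE; exact: H.
  exact: (@lipschitz_continuous _ R _ D K).
have [CD CD0 HD] := clamp_bounded leab cD.
pose KX := n%:R * CA * CX.
have KX0 : 0 <= KX by rewrite mulr_ge0 ?(ltW CX0)// mulr_ge0// ltW.
have Xlip s t : a <= s -> s <= t -> t <= b -> `|X t - X s| <= KX * (t - s).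
  move=> as_ st tb.
  have dg (x : R) : x \in `[a, b] -> is_derive x 1 (fun x : R => KX * x) ((fun=> KX) x).
    move=> _; apply: (is_derive_eq (is_deriveZ KX (is_derive_id x (1 : R)))).
    by rewrite /GRing.scale/= mulr1.
  rewrite mulrBr; apply: mx_comparison dX dg _ as_ st tb => x xab.
  rewrite (le_trans (mulmx_norm_le _ _))// /KX ler_pM// ?mulr_ge0//.
    by rewrite ler_wpM2l//; have := HA x; rewrite clamp_id.
  by have := HX x; rewrite clamp_id.
(* Clamping extends [d] by its end values, which are 0, and keeps it Lipschitz on the line. *)
pose d t := X (clamp a b t) *m D (clamp a b t).
exists d, w, rho, (n%:R * (KX * CD + CX * K)); split => //.
- split => //; apply: lipschitz_mulmx HX HD; exact: lipschitz_itv.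
- by move=> t [ta|bt]; rewrite /d ?(clamp_le leab ta) ?(clamp_ge leab bt) ?Da ?Db mulmx0.
(* The clamped [d] may have corners at [a] and [b]; these two points are discarded. *)
apply: lebesgue_aeS (lebesgue_aeI dD (lebesgue_aeI (lebesgue_ae_neq a) (lebesgue_ae_neq b))) => t.
move=> [dDt [ta tb]] tab.
have /andP[at_ tb_] : a < t < b.
  by move: tab; rewrite in_itv/= !lt_neqAle eq_sym ta tb.
(* The inhomogeneous term appears as [X Y (alpha w - u)], with the product in the other order. *)
have XY : X t *m Y t = 1%:M by apply: mulmx1C; exact: YX.
apply: (@near_eq_is_derive _ _ _ (fun t => X t *m D t)).
  near=> s; rewrite /d clamp_id// in_itv/=; apply/andP; split; apply/ltW.
    by near: s; exact: lt_nbhsr.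
  by near: s; exact: lt_nbhsl.
apply: (is_derive_eq (is_derive_mulmx (dX t tab) dDt)).
by rewrite /d clamp_id// -!mulmxA [X in _ + X]mulmxA XY mul1mx.
Unshelve. all: by end_near. Qed.

End stage_alternative.

(** * Uniform linearization *)

Lemma within_continuous_comp (S T U : topologicalType) (D : set T) (g : T -> U)
    (phi : S -> T) :
  {within D, continuous g} -> continuous phi -> (forall s, D (phi s)) ->
  continuous (fun s => g (phi s)).
Proof.
move=> /subspace_continuousP cg cphi Dphi s V /(cg _ (Dphi s)) HV.
have H : nbhs s (phi @^-1` [set y | D y -> V (g y)]) by exact: (cphi s).
by have := H; apply: filterS => r /=; apply.
Qed.

Section linearization.
Context {R : realType} (n : nat) (f : 'cV[R]_n -> R -> 'cV[R]_n).

(** Chain rule, with the differential of coordinate [k] expanded on the basis vectors [delta_mx j 0]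
    to recover the Jacobian. *)
Lemma is_derive_line (x d : 'cV[R]_n) (t s : R) k :
  differentiable (fun y => f y t) (x + s *: d) ->
  is_derive s 1 (fun s => f (x + s *: d) t k 0) ((jacobian_x f (x + s *: d) t *m d) k 0).
Proof.
move=> df.
pose h := fun y => f y t k 0.
have dh : differentiable h (x + s *: d).
  apply: (@differentiable_comp _ _ _ _ (fun y => f y t) (fun N : 'cV[R]_n => N k 0)) => //.
  exact: differentiable_coord.
have dl : is_derive s 1 (fun s : R => x + s *: d) d.
  apply/is_derive_mxP => i j; rewrite (ord1 j).
  have -> : (fun s : R => (x + s *: d) i 0) = (fun s => x i 0 + s * d i 0).
    by apply/funext => r; rewrite !mxE.
  apply: (is_derive_eq (is_deriveD (is_derive_cst (x i 0) s 1)
    (is_derive_mulE (is_derive_id s (1 : R)) (is_derive_cst (d i 0) s 1)))).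
  by rewrite mul1r mulr0 addr0 add0r.
have dl' : differentiable (fun s : R => x + s *: d) s.
  by apply/derivable1_diffP; have [] := dl.
have dc : differentiable (h \o (fun s : R => x + s *: d)) s.
  exact: differentiable_comp.
split; first exact: diff_derivable.
rewrite (deriveE _ dc) diff_comp//=.
have -> : 'd (fun s : R => x + s *: d) s 1 = d.
  by rewrite -deriveE//; have [_ ->] := dl.
set p := x + s *: d in dh *.
rewrite mxE [in LHS](matrix_sum_delta d) linear_sum/=; apply: eq_bigr => j _.
rewrite big_ord1 linearZ/= mulrC mxE; congr (_ * _).
by rewrite (deriveE (delta_mx j 0) dh).
Qed.

Variables (a b c0 c1 : R).
Hypothesis ab : a <= b.
Hypothesis sub : {subset `[a, b] <= `[c0, c1]}.
Hypothesis df : forall x t, t \in `[c0, c1] -> differentiable (fun y => f y t) x.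
Hypothesis cJ : {within [set p : 'cV[R]_n * R | p.2 \in `[c0, c1]],
  continuous (fun p => jacobian_x f p.1 p.2)}.
Variables x d : R -> 'cV[R]_n.
Hypothesis cx : {within `[a, b], continuous x}.
Hypothesis cd : {within `[a, b], continuous d}.

(** The mean value theorem expresses the error by the variation of the Jacobian between [x t] and a
    point of the segment to [x t + e *: d t]; compactness of [[a, b]] makes it small uniformly in
    [t]. *)
Lemma uniform_linearization eta : 0 < eta -> exists2 e0, 0 < e0 &
  forall e t, 0 < e -> e < e0 -> t \in `[a, b] ->
  `|f (x t + e *: d t) t - f (x t) t - e *: (jacobian_x f (x t) t *m d t)| <= e * eta.
Proof.
move=> eta0.
have cxc := continuous_clamp ab cx; have cdc := continuous_clamp ab cd.
have [Cd Cd0 HCd] := clamp_bounded ab cd.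
(* [n Cd] is the factor lost when an increment of the Jacobian multiplies [d]; adding 1 keeps the
   divisor of [eta] positive. *)
pose K := n%:R * Cd + 1.
have K0 : 0 < K by rewrite ltr_wpDl// mulr_ge0// ltW.
pose phi (p : R * R) : 'cV[R]_n * R :=
  (x (clamp a b p.2) + p.1 *: d (clamp a b p.2), clamp a b p.2).
have cphi : continuous phi.
  move=> p; have c2 : {for p, continuous (fun p : R * R => clamp a b p.2)}.
    by apply: continuous_comp; [exact: cvg_snd|exact: clamp_continuous].
  have c3 : {for p, continuous (fun p : R * R => x (clamp a b p.2))}.
    by apply: (@continuous_comp _ _ _ snd (x \o clamp a b)); [exact: cvg_snd|exact: cxc].
  have c4 : {for p, continuous (fun p : R * R => d (clamp a b p.2))}.
    by apply: (@continuous_comp _ _ _ snd (d \o clamp a b)); [exact: cvg_snd|exact: cdc].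
  have c5 : {for p, continuous (fun p : R * R => p.1)} by exact: cvg_fst.
  exact: (cvg_pair (cvgD c3 (cvgZ c5 c4)) c2).
pose H p := jacobian_x f (phi p).1 (phi p).2.
have cH : continuous H.
  apply: (within_continuous_comp cJ cphi) => p /=; apply: sub; exact: clamp_itv.
have [eta' eta'0 etaE] : exists2 eta', 0 < eta' & eta = eta' * K.
  by exists (eta / K); rewrite ?divr_gt0// divfK// gt_eqF.
(* Compactness turns the estimates near [s = 0] around each [t] into one neighbourhood of 0 valid
   for all [t] in [[a, b]]. *)
have /compact_near_coveringP/(_ R (nbhs (0 : R))
  (fun s t => `|H (s, t) - H (0, t)| <= eta') _) := @segment_compact _ a b.
case=> [t _|e0 /= e00 He0].
  have eta2 : 0 < eta' / 2 by rewrite divr_gt0.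
  have /cvgrPdist_le/(_ _ eta2) [[U V] /= [HU HV] UV] := cH (0, t).
  exists (V, U) => //= [[t' s]] /= [Vt Us].
  have h1 := UV (s, t') (conj Us Vt).
  have h2 := UV (0, t') (conj (nbhs_singleton HU) Vt).
  have -> : H (s, t') - H (0, t') = (H (0, t) - H (0, t')) - (H (0, t) - H (s, t')).
    by rewrite opprB [RHS]addrC subrKA.
  move: h1 h2; move: (H (0, t)) (H (s, t')) (H (0, t')) => X1 X2 X3 h1 h2.
  apply: (le_trans (ler_normB _ _)); rewrite (splitr eta'); exact: lerD h2 h1.
exists e0 => // e t e_gt0 ee0 tab.
apply: mx_norm_le => [|k j]; first by rewrite mulr_ge0// ltW.
rewrite (ord1 j).
pose g s := f (x t + s *: d t) t k 0.
have dg (s : R) : is_derive s 1 g ((jacobian_x f (x t + s *: d t) t *m d t) k 0).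
  by apply: is_derive_line; apply: df; exact: sub.
have cg : {within `[0, e], continuous g}.
  by apply: derivable_within_continuous => s _; have [] := dg s.
(* The intermediate point [s] depends on [t] and on the coordinate, which the uniform choice of [e0]
   absorbs. *)
have [s] := @MVT _ g (fun s => (jacobian_x f (x t + s *: d t) t *m d t) k 0) 0 e
  e_gt0 (fun s _ => dg s) cg.
rewrite in_itv/= subr0 => /andP[s0 se] E.
have HE r : H (r, t) = jacobian_x f (x t + r *: d t) t by rewrite /H /phi/= clamp_id.
have -> : (f (x t + e *: d t) t - f (x t) t - e *: (jacobian_x f (x t) t *m d t)) k 0
    = e * ((H (s, t) - H (0, t)) *m d t) k 0.
  rewrite !HE scale0r addr0 mulmxBl.
  have := E; rewrite /g scale0r addr0 => E'.
  by rewrite !mxE E' mxE; ring.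
rewrite normrM (gtr0_norm e_gt0) ler_wpM2l ?(ltW e_gt0)//.
rewrite (le_trans (mx_entry_le _ _ _))// (le_trans (mulmx_norm_le _ _))//.
have h1 : `|H (s, t) - H (0, t)| <= eta'.
  by apply: He0; rewrite /= ?sub0r ?normrN ?gtr0_norm// (lt_trans se).
have h2 : `|d t| <= Cd by have := HCd t; rewrite clamp_id.
apply: (@le_trans _ _ (n%:R * eta' * Cd)).
  rewrite -!mulrA; apply: ler_wpM2l => //; exact: ler_pM.
have -> : n%:R * eta' * Cd = eta' * (n%:R * Cd) by ring.
by rewrite etaE ler_pM2l// lerDl.
Qed.

End linearization.

(** * Essential suprema and absolute continuity *)

Section essential_norm.
Context {R : realType} (V : normedModType R) (i : interval R).
Implicit Types g h : R -> V.

(** An exceptional set is cut down to its trace on [i] in one direction and enlarged by the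
    complement of [i] in the other. *)
Lemma ae_mrestrP (P : R -> Prop) :
  {ae mrestr lebesgue_measure (measurable_itv i), forall t, P t} <->
  {ae lebesgue_measure, forall t : R, t \in i -> P t}.
Proof.
split=> [[N [mN N0 PN]]|[N [mN N0 PN]]].
  exists (N `&` [set` i]); split => //; first exact: measurableI.
  move=> t /= nP; split.
    by apply: PN => /= Pt; apply: nP.
  by apply: contrapT => ti; apply: nP.
exists (N `|` ~` [set` i]); split.
- by apply: measurableU => //; apply: measurableC.
- rewrite /mrestr/= setIUl setICl setU0.
  by apply/eqP; rewrite -measure_le0 -N0 le_measure// ?inE//; exact: measurableI.
- move=> t /= nP; have [ti|ti] := pselect ([set` i] t); last by right.
  by left; apply: PN => /= H; apply: nP; exact: H.
Qed.

Lemma ess_norm_leP g (K : R) : (ess_norm i g <= K%:E)%E <->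
  {ae lebesgue_measure, forall t : R, t \in i -> `|g t| <= K}.
Proof.
split.
  by move=> /ess_supP H; apply/ae_mrestrP; exact: H.
by move=> /ae_mrestrP H; apply/ess_supP; exact: H.
Qed.

Lemma ess_norm_ltyP g : (ess_norm i g < +oo)%E <->
  exists K, {ae lebesgue_measure, forall t : R, t \in i -> `|g t| <= K}.
Proof.
split=> [|[K /ess_norm_leP H]]; last exact: le_lt_trans H (ltry _).
case E : (ess_norm i g) => [r| |]// _.
  by exists r; apply/ess_norm_leP; rewrite E.
by exists 0; apply/ess_norm_leP; rewrite E leNye.
Qed.

Lemma eq_ess_norm g h :
  {ae lebesgue_measure, forall t : R, t \in i -> g t = h t} ->
  ess_norm i g = ess_norm i h.
Proof.
move=> H; apply: eq_ess_sup; apply/ae_mrestrP.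
by apply: lebesgue_aeS H => t H ti; rewrite H.
Qed.

End essential_norm.

Section absolute_continuity.
Context {R : realType} (V : normedModType R) (i : interval R).
Implicit Types g h : R -> V.

Lemma lipschitz_abs_continuous g (L : R) :
  (forall s t, s \in i -> t \in i -> s <= t -> `|g t - g s| <= L * (t - s)) -> abs_continuous i g.
Proof.
move=> H e e0; have L1 : 0 < `|L| + 1 by rewrite ltr_wpDl.
exists (e / (`|L| + 1)); first by rewrite divr_gt0.
move=> m p q pq _; rewrite ltr_pdivlMr// => lt_e; apply: le_lt_trans lt_e.
rewrite mulr_suml; apply: ler_sum => k _; have [pk qk lepq] := pq k.
rewrite (le_trans (H _ _ pk qk lepq))// mulrC ler_wpM2l ?subr_ge0//.
by rewrite (le_trans (ler_norm L))// lerDl.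
Qed.

Lemma abs_continuousD g h : abs_continuous i g -> abs_continuous i h ->
  abs_continuous i (fun t => g t + h t).
Proof.
move=> ag ah e e0; have e2 : 0 < e / 2 by rewrite divr_gt0.
have [d1 d10 H1] := ag _ e2; have [d2 d20 H2] := ah _ e2.
exists (Num.min d1 d2); first by rewrite lt_min d10.
move=> m p q pq tr; rewrite lt_min => /andP[l1 l2].
rewrite (splitr e); apply: le_lt_trans (ltrD (H1 m p q pq tr l1) (H2 m p q pq tr l2)).
rewrite -big_split/=; apply: ler_sum => k _.
by rewrite opprD addrACA ler_normD.
Qed.

End absolute_continuity.

Lemma abs_continuous_continuous {R : realType} (V : normedModType R) (a b : R)
    (g : R -> V) : abs_continuous `[a, b] g -> {within `[a, b], continuous g}.
Proof.
move=> ag; apply/subspace_continuousP => t tab; apply/cvgrPdist_le => e e0.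
have [d d0 H] := ag _ e0.
have H1 s r : s \in `[a, b] -> r \in `[a, b] -> s <= r -> r - s < d -> `|g r - g s| <= e.
  move=> sab rab sr srd.
  have := H 1%N (fun=> s) (fun=> r); rewrite !big_ord1 => /(_ _ _ srd) h.
  apply/ltW/h; first by split.
  by move=> k l _ _ _; rewrite (ord1 k) (ord1 l).
have : nbhs t (ball t d) by exact: nbhsx_ballx.
apply: filterS => s ts sab; have [st|/ltW ts'] := leP s t.
  apply: H1 => //; rewrite -(@ger0_norm _ (t - s)) ?subr_ge0//.
rewrite distrC; apply: H1 => //; rewrite -(@ger0_norm _ (s - t)) ?subr_ge0//.
by rewrite distrC.
Qed.

(** * Variations of an optimal trajectory *)

Lemma within_within_comp (S T U : topologicalType) (E : set S) (D : set T) (g : T -> U)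
    (phi : S -> T) :
  {within D, continuous g} -> {within E, continuous phi} ->
  (forall s, E s -> D (phi s)) ->
  {within E, continuous (fun s => g (phi s))}.
Proof.
move=> /subspace_continuousP cg /subspace_continuousP cphi Dphi.
apply/subspace_continuousP => s Es V /(cg _ (Dphi s Es)) HV.
have H : nbhs s [set r | E r -> D (phi r) -> V (g (phi r))] := cphi s Es _ HV.
by have := H; apply: filterS => r /= H1 Er; apply: H1 => //; exact: Dphi.
Qed.

Section optimality.
Context {R : realType} (n N : nat) (T : nat -> R) (z : nat -> 'cV[R]_n).
Variables (f : 'cV[R]_n -> R -> 'cV[R]_n) (x u : R -> 'cV[R]_n) (alpha : nat -> R).
Hypothesis hT : forall i, (i < N)%N -> T i < T i.+1.
Hypothesis hf : regular_field N T f.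
Hypothesis hsol : PLinf_solution N T z f x u.
Hypothesis halpha : forall i, (i < N)%N -> (alpha i)%:E = ess_norm `[T i, T i.+1] u.
Hypothesis halpha_gt0 : forall i, (i < N)%N -> 0 < alpha i.

Lemma grid_le i j : (i <= j)%N -> (j <= N)%N -> T i <= T j.
Proof.
elim: j => [|j IH]; first by rewrite leqn0 => /eqP ->.
rewrite leq_eqVlt => /predU1P[->//|ij jN].
by rewrite (le_trans (IH _ (ltnW jN)))// ltW// hT.
Qed.

Lemma stage_sub i : (i < N)%N -> {subset `[T i, T i.+1] <= `[T 0, T N]}.
Proof.
move=> iN t; rewrite !in_itv/= => /andP[h1 h2].
by rewrite (le_trans (grid_le (leq0n i) (ltnW iN)))// (le_trans h2)// grid_le.
Qed.

Lemma trajectory_continuous : {within `[T 0, T N], continuous x}.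
Proof. by have [[[ax _ _] _ _ _] _] := hsol; exact: abs_continuous_continuous. Qed.

Lemma continuous_along (U : topologicalType) (g : 'cV[R]_n -> R -> U) (y : R -> 'cV[R]_n) :
  {within [set p : 'cV[R]_n * R | p.2 \in `[T 0, T N]], continuous (fun p => g p.1 p.2)} ->
  {within `[T 0, T N], continuous y} ->
  {within `[T 0, T N], continuous (fun t => g (y t) t)}.
Proof.
move=> cg cy.
apply: (@within_within_comp _ _ _ _ _ (fun p => g p.1 p.2) (fun t => (y t, t)) cg) => //.
have cid : {within `[T 0, T N], continuous (fun t : R => t)}.
  by apply: continuous_subspaceT => t; exact: cvg_id.
move=> t; exact: (cvg_pair (cy t) (cid t)).
Qed.

Section variation.
Variable i : nat.
Hypothesis iN : (i < N)%N.
Let a := T i.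
Let b := T i.+1.
Variables (ubar d w : R -> 'cV[R]_n) (rho L : R).
Hypothesis ubarE : {ae lebesgue_measure, forall t : R, t \in `[a, b] -> u t = ubar t}.
Hypothesis mubar : forall j, measurable_fun [set: R] (fun t => ubar t j 0).
Hypothesis bubar : forall t j, `|ubar t j 0| <= alpha i.
Hypothesis rho0 : 0 <= rho.
Hypothesis dL : forall s t, `|d t - d s| <= L * `|t - s|.
Hypothesis d0 : forall t, t <= a \/ b <= t -> d t = 0.
Hypothesis cw : continuous w.
Hypothesis wrho : forall t j, `|w t j 0| <= rho.
Hypothesis dd : {ae lebesgue_measure, forall t : R, t \in `[a, b] ->
  is_derive t 1 d (jacobian_x f (x t) t *m d t + (alpha i *: w t - ubar t))}.

Let A t := jacobian_x f (x t) t.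
(** The forcing term of the equation for [d], extended by 0 so that the equation holds almost
    everywhere on the line. *)
Let g0 t : 'cV[R]_n := if t \in `[a, b] then alpha i *: w t - ubar t else 0.
Let ab : a < b. Proof. exact: hT. Qed.

Let cd : continuous d.
Proof. exact: (@lipschitz_continuous _ R _ d L). Qed.

Let cA : {within `[T 0, T N], continuous A}.
Proof. by have [_ _ cJ] := hf; apply: continuous_along cJ trajectory_continuous. Qed.

Let d_out t : t \notin `[a, b] -> d t = 0.
Proof.
rewrite in_itv/= negb_and -!ltNge => /orP[ta|bt]; apply: d0.
  by left; exact: ltW.
by right; exact: ltW.
Qed.

Let ddg : {ae lebesgue_measure, forall t : R, is_derive t 1 d (A t *m d t + g0 t)}.
Proof.
apply: lebesgue_aeS dd => t H; rewrite /g0; case: ifPn => [/H//|tab].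
rewrite d_out// mulmx0 add0r.
have D0 : is_derive t 1 (cst 0 : R -> 'cV[R]_n) 0 by exact: is_derive_cst.
apply: near_eq_is_derive D0.
have : \forall s \near t, s \notin `[a, b].
  move: tab; rewrite in_itv/= negb_and -!ltNge => /orP[ta|bt].
    near=> s; rewrite in_itv/= negb_and -ltNge; apply/orP; left.
    by near: s; exact: lt_nbhsl.
  near=> s; rewrite in_itv/= negb_and -!ltNge; apply/orP; right.
  by near: s; exact: lt_nbhsr.
by apply: filterS => s /d_out ->.
Unshelve. all: by end_near. Qed.

Variable e : R.
Hypothesis e0 : 0 < e.
Let y t := x t + e *: d t.
(** This is [y' - f(y, t)], so that [y] satisfies the dynamics exactly and not merely to first order
    in [e]. *)
Let w' t := u t + e *: (A t *m d t + g0 t) - (f (y t) t - f (x t) t).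

Let w'_out t : t \notin `[a, b] -> w' t = u t.
Proof.
move=> tab; rewrite /w' /y /g0 (negbTE tab) d_out//.
by rewrite !(mulmx0, scaler0, addr0) subrr subr0.
Qed.

Let cy : {within `[T 0, T N], continuous y}.
Proof.
move=> t; apply: cvgD; first exact: trajectory_continuous.
apply: cvgZr; exact: (continuous_subspaceT cd).
Qed.

Let y_derive : {ae lebesgue_measure, forall t : R, t \in `[T 0, T N] ->
  is_derive t 1 y (f (y t) t + w' t)}.
Proof.
have [[_ _ hx _] _] := hsol.
apply: lebesgue_aeS (lebesgue_aeI hx ddg) => t [H1 H2] tT.
apply: (is_derive_eq (is_deriveD (H1 tT) (is_deriveZ e H2))).
by rewrite /w' opprB [RHS]addrC -[RHS]addrA subrK [RHS]addrC addrA.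
Qed.

Let fy_bounded : exists K, forall t : R, t \in `[T 0, T N] -> `|f (y t) t| <= K.
Proof.
have TT : T 0 <= T N := grid_le (leq0n N) (leqnn N).
have [cf _ _] := hf.
have [K _ HK] := clamp_bounded TT (continuous_along cf cy).
by exists K => t tT; have := HK t; rewrite clamp_id.
Qed.

Let w'_measurable j : measurable_fun `[T 0, T N] (fun t => w' t j 0).
Proof.
have [[_ [mu _] _ _] _] := hsol; have [cf _ _] := hf.
have cmeas (g : R -> 'cV[R]_n) : {within `[T 0, T N], continuous g} ->
    measurable_fun `[T 0, T N] (fun t => g t j 0).
  move=> cg; apply: subspace_continuous_measurable_fun => //.
  by move=> t; exact: ((@continuous_mxP R (subspace `[T 0, T N]%classic) _ _ g t).1 (cg t) j 0).
have -> : (fun t => w' t j 0) = (fun t => u t j 0 + e * ((A t *m d t) j 0 + g0 t j 0)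
    - (f (y t) t j 0 - f (x t) t j 0)).
  by apply/funext => t; rewrite /w' !mxE.
apply: measurable_funB; last first.
  by apply: measurable_funB; apply: cmeas;
    apply: continuous_along => //; exact: trajectory_continuous.
apply: measurable_funD; first exact: mu.
apply: measurable_funM; first exact: measurable_cst.
apply: measurable_funD.
  apply: cmeas => t; apply: (@continuous_mulmx R (subspace `[T 0, T N]%classic)); first exact: cA.
  exact: (continuous_subspaceT cd).
apply: measurable_funTS.
have -> : (fun t => g0 t j 0) =
    (fun t => if t \in `[a, b] then alpha i * w t j 0 - ubar t j 0 else 0).
  by apply/funext => t; rewrite /g0; case: ifP => _; rewrite !mxE.
apply: measurable_fun_if => //.
- apply: (@measurable_fun_bool _ _ _ _ true).
  rewrite setTI (_ : _ @^-1` _ = [set` `[a, b]])//.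
- apply: measurable_funTS; apply: measurable_funB => //.
  apply: measurable_funM; first exact: measurable_cst.
  by apply: continuous_measurable_fun => t; exact: ((continuous_mxP _ _).1 (@cw t) j 0).
Qed.

Hypothesis e1 : e <= 1.
Variable eta : R.
Hypothesis lin : forall t, t \in `[a, b] ->
  `|f (y t) t - f (x t) t - e *: (A t *m d t)| <= e * eta.

(** On the stage [w'] is [(1 - e) u + e alpha w] minus the linearization error; these have norms at
    most [(1 - e) alpha + e alpha rho] and [e eta]. *)
Let w'_stage : {ae lebesgue_measure, forall t : R, t \in `[a, b] ->
  `|w' t| <= alpha i - e * (alpha i * (1 - rho) - eta)}.
Proof.
apply: lebesgue_aeS ubarE => t H tab; have {}H := H tab.
have al0 : 0 < alpha i := halpha_gt0 iN.
have -> : w' t = (u t + e *: (alpha i *: w t - ubar t)) -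
    (f (y t) t - f (x t) t - e *: (A t *m d t)).
  rewrite /w' /g0 tab; move: (A t *m d t) (alpha i *: w t - ubar t) => P Q.
  by apply/matrixP => p q; rewrite !mxE; ring.
rewrite (le_trans (ler_normB _ _))//.
have -> : alpha i - e * (alpha i * (1 - rho) - eta) =
    (1 - e) * alpha i + e * (alpha i * rho) + e * eta by ring.
apply: lerD; last exact: lin.
apply: mx_norm_le => [|j k].
  by rewrite addr_ge0// !mulr_ge0 ?subr_ge0// ltW.
rewrite (ord1 k) !mxE H.
have -> : ubar t j 0 + e * (alpha i * w t j 0 - ubar t j 0) =
  (1 - e) * ubar t j 0 + e * (alpha i * w t j 0) by ring.
rewrite (le_trans (ler_normD _ _))// lerD//.
  by rewrite normrM ger0_norm ?subr_ge0// ler_wpM2l ?subr_ge0.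
by rewrite !normrM (gtr0_norm e0) (gtr0_norm al0) !ler_pM2l.
Qed.

Hypothesis gain : 0 < alpha i * (1 - rho) - eta.

Let w'_feasible : PLinf_feasible N T z f y w'.
Proof.
have [[[ax dx ndx] [mu lu] hx xz] _] := hsol.
have [Ku HKu] := (ess_norm_ltyP _ _).1 lu.
have [Kf HKf] := fy_bounded.
have w'K : {ae lebesgue_measure, forall t : R, t \in `[T 0, T N] ->
    `|w' t| <= `|Ku| + alpha i}.
  apply: lebesgue_aeS (lebesgue_aeI HKu w'_stage) => t [H1 H2] tT.
  case: (boolP (t \in `[a, b])) => tab.
    apply: (le_trans (H2 tab)); rewrite (@le_trans _ _ (alpha i))//; last by rewrite lerDr.
    by rewrite gerBl mulr_ge0// ltW.
  rewrite w'_out// (le_trans (H1 tT))// (le_trans (ler_norm _))// lerDl.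
  exact/ltW/halpha_gt0.
split.
- split.
  + apply: abs_continuousD ax _.
    apply: (@lipschitz_abs_continuous _ _ _ _ (e * L)) => s t _ _ st.
    rewrite -scalerBr normrZ (gtr0_norm e0) -mulrA ler_pM2l//.
    by rewrite -(@ger0_norm _ (t - s)) ?subr_ge0.
  + by apply: lebesgue_aeS y_derive => t H tT; have [] := H tT.
  + apply/ess_norm_ltyP; exists (Kf + (`|Ku| + alpha i)).
    apply: lebesgue_aeS (lebesgue_aeI y_derive w'K) => t [H1 H2] tT.
    rewrite derive1E; have [_ ->] := H1 tT.
    by rewrite (le_trans (ler_normD _ _))// lerD ?HKf ?H2.
- split; first exact: w'_measurable.
  by apply/ess_norm_ltyP; exists (`|Ku| + alpha i).
- exact: y_derive.
(* Every node lies at or beyond an end of stage [i], where [d] vanishes, so the interpolation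
   conditions persist. *)
- move=> k kN; rewrite /y d0 ?scaler0 ?addr0 ?xz//.
  have [ki|ik] := leqP k i; first by left; apply: grid_le => //; exact: ltnW.
  by right; exact: grid_le.
Qed.

(** The cost changes only in stage [i], where [gain] pushes the essential norm below [alpha i]. *)
Lemma no_better_variation : False.
Proof.
have [_ opt] := hsol; have := opt _ _ w'_feasible.
rewrite leNgt => /negP; apply; rewrite /PLinf_cost.
rewrite (bigD1 (Ordinal iN))//= [ltRHS](bigD1 (Ordinal iN))//=.
have -> : (\sum_(k < N | k != Ordinal iN) ess_norm `[T k, T k.+1] w' =
    \sum_(k < N | k != Ordinal iN) (alpha k)%:E)%E.
  apply: eq_bigr => k ki; rewrite halpha//; apply: eq_ess_norm.
  (* Another stage can meet stage [i] only in [a] or [b], which are null. *)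
  apply: lebesgue_aeS (lebesgue_aeI (lebesgue_ae_neq a) (lebesgue_ae_neq b)) => t [ta tb].
  move=> tk; apply: w'_out; move: tk; rewrite !in_itv/= => /andP[kt tk].
  have [ki'|ik|kiE] := ltngtP k i.
  - rewrite negb_and -ltNge lt_neqAle ta/=; apply/orP; left.
    by apply: (le_trans tk); apply: grid_le => //; exact: ltnW.
  - rewrite negb_and -!ltNge orbC lt_neqAle eq_sym tb/=; apply/orP; left.
    by apply: le_trans kt; apply: grid_le => //; exact: ltnW.
  - by case/eqP: ki; apply: val_inj.
have -> : (\sum_(k < N | k != Ordinal iN) ess_norm `[T k, T k.+1] u =
    \sum_(k < N | k != Ordinal iN) (alpha k)%:E)%E.
  by apply: eq_bigr => k _; rewrite halpha.
rewrite -halpha// sumEFin lteD2rE//.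
rewrite (@le_lt_trans _ _ (alpha i - e * (alpha i * (1 - rho) - eta))%:E)//.
  by apply/ess_norm_leP; exact: w'_stage.
by rewrite lte_fin gtrBl mulr_gt0.
Qed.

End variation.
End optimality.

(** * Multipliers *)

Section stage.
Context {R : realType} (n N : nat) (T : nat -> R) (z : nat -> 'cV[R]_n).
Variables (f : 'cV[R]_n -> R -> 'cV[R]_n) (x u v : R -> 'cV[R]_n) (alpha : nat -> R).
Hypothesis hT : forall i, (i < N)%N -> T i < T i.+1.
Hypothesis hf : regular_field N T f.
Hypothesis hsol : PLinf_solution N T z f x u.
Hypothesis halpha : forall i, (i < N)%N -> (alpha i)%:E = ess_norm `[T i, T i.+1] u.
Hypothesis halpha_gt0 : forall i, (i < N)%N -> 0 < alpha i.
Hypothesis huv : forall i, (i < N)%N ->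
  {ae lebesgue_measure, forall t : R, t \in `[T i, T i.+1] -> u t = alpha i *: v t}.

Variable i : nat.
Hypothesis iN : (i < N)%N.
Let a := T i.
Let b := T i.+1.
Let A t := jacobian_x f (x t) t.
Let ab : a < b. Proof. exact: hT. Qed.
Let leab : a <= b. Proof. exact: ltW. Qed.
Let al0 : 0 < alpha i. Proof. exact: halpha_gt0. Qed.
Let sub : {subset `[a, b] <= `[T 0, T N]}. Proof. by move=> t; exact: (stage_sub (@hT) iN). Qed.

Let u_le : {ae lebesgue_measure, forall t : R, t \in `[a, b] -> `|u t| <= alpha i}.
Proof. by apply/ess_norm_leP; rewrite halpha. Qed.

Let cA : {within `[a, b], continuous A}.
Proof.
apply: (@continuous_subspaceW _ _ _ `[T 0, T N]%classic); first exact: sub.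
have [_ _ cJ] := hf.
exact: (continuous_along cJ (trajectory_continuous hsol)).
Qed.

(** The second case of [stage_alternative] would produce a feasible pair of smaller cost, so
    optimality leaves only the first. *)
Lemma stage_adjoint : exists l : R -> 'rV[R]_n,
  (forall t : R, t \in `[a, b] -> is_derive t 1 l (- (l t *m A t)) /\ l t != 0) /\
  {ae lebesgue_measure, forall t : R, t \in `[a, b] ->
     forall j, alpha i * `|l t 0 j| + l t 0 j * u t j 0 = 0}.
Proof.
(* A representative of [u] on the stage, bounded by [alpha i] at every point and measurable on the
   line. *)
pose ubar t : 'cV[R]_n :=
  if t \in `[a, b] then \col_j clamp (- alpha i) (alpha i) (u t j 0) else 0.
have alN : - alpha i <= alpha i by rewrite ge0_cp// ltW.
have uE : {ae lebesgue_measure, forall t : R, t \in `[a, b] -> u t = ubar t}.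
  apply: lebesgue_aeS u_le => t H tab; rewrite /ubar tab.
  apply/matrixP => j k; rewrite (ord1 k) mxE clamp_id// in_itv/= -ler_norml.
  exact: le_trans (mx_entry_le _ _ _) (H tab).
have mubar j : measurable_fun [set: R] (fun t => ubar t j 0).
  have -> : (fun t => ubar t j 0) =
      (fun t => if t \in `[a, b] then clamp (- alpha i) (alpha i) (u t j 0) else 0).
    by apply/funext => t; rewrite /ubar; case: ifP => _; rewrite !mxE.
  apply: measurable_fun_if => //.
    apply: (@measurable_fun_bool _ _ _ _ true).
    by rewrite setTI (_ : _ @^-1` _ = [set` `[a, b]]).
  rewrite setTI; apply: (@measurableT_comp _ _ _ _ _ _ (clamp (- alpha i) (alpha i))).
    by apply: continuous_measurable_fun; exact: clamp_continuous.
  have [[_ [mu _] _ _] _] := hsol.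
  by apply: measurable_funS (mu j) => //; exact: sub.
have bubar t j : `|ubar t j 0| <= alpha i.
  have al0' := ltW al0; rewrite /ubar; case: ifP => _; rewrite mxE ?normr0//.
  by rewrite ler_norml; have := clamp_itv (u t j 0) alN; rewrite in_itv.
case: (stage_alternative ab cA al0 mubar bubar) => [[l [Hl1 Hl2]]|].
  exists l; split=> //; apply: lebesgue_aeS (lebesgue_aeI uE Hl2) => t [H1 H2] tab j.
  by rewrite H1//; exact: H2.
move=> [d [w [rho [L [[rho1 dL] d0 cw wrho dd]]]]]; exfalso.
have cd : continuous d by exact: (@lipschitz_continuous _ R _ d L).
(* The bound on [w] forces [rho >= 0] only if there is a coordinate, hence the maximum with 0. *)
pose rho' := Num.max rho 0.
have rho'0 : 0 <= rho' by rewrite le_max lexx orbT.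
have rho'1 : rho' < 1 by rewrite gt_max rho1 ltr01.
have wrho' t j : `|w t j 0| <= rho' by rewrite (le_trans (wrho t j))// le_max lexx.
(* Half of the first-order gain [alpha i * (1 - rho')] is spent on the linearization error; the
   other half remains. *)
pose eta := alpha i * (1 - rho') / 2.
have eta0 : 0 < eta by rewrite divr_gt0// mulr_gt0// subr_gt0.
have [_ df cJ] := hf.
have cx : {within `[a, b], continuous x}.
  apply: (@continuous_subspaceW _ _ _ `[T 0, T N]%classic); first exact: sub.
  exact: trajectory_continuous hsol.
have [e0 e00 He0] := uniform_linearization leab sub df cJ cx (continuous_subspaceT cd) eta0.
pose e := Num.min e0 1 / 2.
have me0 : 0 < Num.min e0 1 by rewrite lt_min e00 ltr01.
have e_gt0 : 0 < e by rewrite divr_gt0.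
have e_lt : e < Num.min e0 1 by rewrite ltr_pdivrMr// mulr2n mulrDr mulr1 ltrDl.
have /andP[ee0 e1] : (e < e0) && (e < 1) by rewrite -lt_min.
apply: (@no_better_variation _ _ _ _ _ _ _ _ _ (@hT) hf hsol (@halpha) (@halpha_gt0) i iN
  ubar d w rho' L uE mubar bubar rho'0 dL d0 cw wrho' dd e e_gt0 (ltW e1) eta).
  by move=> t tab; exact: He0.
by have -> : alpha i * (1 - rho') - eta = eta by rewrite /eta; field.
Qed.

(** [lambda] is a positive multiple of the transposed [l], and [mu] is the primitive of
    [g = - 1 + |lambda|_1]. The sign condition makes this continuous [g] agree with
    [- 1 - lambda^T v] almost everywhere on the stage. *)
Lemma stage_multiplier : exists (lambda : R -> 'cV[R]_n) (mu g : R -> R) (K : R),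
  [/\ forall t : R, t \in `[a, b] -> is_derive t 1 lambda (- ((A t)^T *m lambda t)),
      [/\ forall s t, s <= t -> `|mu t - mu s| <= K * (t - s), mu a = 0 & mu b = 0],
      forall t : R, is_derive t 1 mu (g t) /\ `|g t| <= K,
      {ae lebesgue_measure, forall t : R, t \in `[a, b] ->
         g t = - 1 - \sum_(j < n) lambda t j 0 * v t j 0} &
      {ae lebesgue_measure, forall t : R, t \in `[a, b] ->
         forall j : 'I_n,
           [/\ lambda t j 0 < 0 -> v t j 0 = 1,
               lambda t j 0 > 0 -> v t j 0 = - 1
             & `|v t j 0| <= 1]}].
Proof.
have [l [dl Hl]] := stage_adjoint.
have cl : {within `[a, b], continuous l}.
  by apply: derivable_within_continuous => t /dl[[]].
have clc : continuous (fun t => l (clamp a b t)) := continuous_clamp leab cl.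
pose h t := \sum_j `|l (clamp a b t) 0 j|.
have ch : continuous h.
  move=> t; apply: continuous_sumE => j.
  apply: (@continuous_comp _ _ _ (fun t => l (clamp a b t) 0 j) (fun y : R => `|y|)).
    exact: ((continuous_mxP _ _).1 (clc t) 0 j).
  exact: norm_continuous.
(* [l] never vanishes, so its l_1 norm has a positive integral and can be normalized. *)
have h_gt0 t : 0 < h t.
  have tab := clamp_itv t leab.
  have [_ l0] := dl _ tab.
  have [j lj] : exists j, l (clamp a b t) 0 j != 0.
    apply: contrapT => H; move/eqP: l0; apply; apply/matrixP => k j.
    rewrite (ord1 k) mxE; apply/eqP; apply: contraT => lj.
    by exfalso; apply: H; exists j.
  rewrite /h (bigD1 j)//=; apply: ltr_pwDl; first by rewrite normr_gt0.
  exact: sumr_ge0.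
have hE t : h (clamp a b t) = h t.
  by rewrite /h (clamp_id (clamp_itv t leab)).
have [K0 K00 hK0] := clamp_bounded leab (continuous_subspaceT ch).
have bh : bounded_measurable h.
  by apply: (@bounded_measurable_continuous _ _ K0) => // t; have := hK0 t; rewrite hE.
pose I := \int[lebesgue_measure]_(t in `[a, b]) h t.
have I0 : 0 < I.
  have [c _ hc] := EVT_min leab (continuous_subspaceT ch).
  apply: (@lt_le_trans _ _ (h c * (b - a))); first by rewrite mulr_gt0// subr_gt0.
  rewrite -(integral_cst_bm leab); apply: le_integral_bm => //.
  exact: bounded_measurable_cst.
(* With this factor the integral of [s * h] is [b - a], which is what [mu b = 0] demands. *)
pose s := (b - a) / I.
have s0 : 0 < s by rewrite divr_gt0// subr_gt0.
pose lambda t : 'cV[R]_n := s *: (l t)^T.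
pose g t := - 1 + s * h t.
have cg : continuous g.
  by move=> t; apply: cvgD; [exact: cvg_cst|apply: cvgM; [exact: cvg_cst|exact: ch]].
have bs := bounded_measurableM (bounded_measurable_cst s) bh.
have [mg [K gK]] : bounded_measurable g.
  by apply: bounded_measurableD bs; exact: bounded_measurable_cst.
have [mua mulip _ muder mub] := primitiveP a mg gK.
exists lambda, (primitive a g), g, K; split.
- move=> t tab; have [dlt _] := dl t tab.
  apply: (is_derive_eq (is_deriveZ s (is_derive_trmx dlt))).
  by rewrite /lambda linearN/= trmx_mul scalerN -scalemxAr.
- split=> //; rewrite mub//.
  rewrite (integralD_bm a b (bounded_measurable_cst (-1)) bs) integralZ_bm// integral_cst_bm//.
  by rewrite -/I /s divfK ?gt_eqF// mulN1r addNr.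
- by move=> t; split; [apply: muder; exact: cg|exact: gK].
- apply: lebesgue_aeS (lebesgue_aeI Hl (huv iN)) => t [H1 H2] tab.
  rewrite /g /h clamp_id// mulr_sumr -sumrN; congr (_ + _); apply: eq_bigr => j _.
  have := H1 tab j; rewrite H2// !mxE => H.
  have : alpha i * (`|l t 0 j| + l t 0 j * v t j 0) = 0 by rewrite -H; ring.
  move/eqP; rewrite mulf_eq0 (gt_eqF al0)/= => /eqP H'.
  by rewrite -mulrA -mulrN; congr (_ * _); lra.
- apply: lebesgue_aeS (lebesgue_aeI Hl (lebesgue_aeI (huv iN) u_le)) => t [H1 [H2 H3]] tab j.
  have := H1 tab j; rewrite H2// !mxE => H.
  have : alpha i * (`|l t 0 j| + l t 0 j * v t j 0) = 0 by rewrite -H; ring.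
  move/eqP; rewrite mulf_eq0 (gt_eqF al0)/= => /eqP H'.
  split.
  (* Since [s > 0], [lambda] has the signs of [l]; then [|l_j| + l_j v_j = 0] is solved for
     [v_j]. *)
  + rewrite (pmulr_rlt0 _ s0) => lj; move: H'; rewrite ltr0_norm// => H'.
    apply: (mulfI (ltr0_neq0 lj)); lra.
  + rewrite (pmulr_rgt0 _ s0) => lj; move: H'; rewrite gtr0_norm// => H'.
    apply: (mulfI (lt0r_neq0 lj)); lra.
  + have := le_trans (mx_entry_le (u t) j 0) (H3 tab).
    by rewrite H2// mxE normrM (gtr0_norm al0) ger_pMr.
Qed.

End stage.

(** * Gluing the multipliers of the stages *)

Lemma near_itv_oo {R : realType} (a b t : R) : t \in `]a, b[ -> \forall s \near t, s \in `]a, b[.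
Proof.
rewrite in_itv/= => /andP[at_ tb]; near=> s; rewrite in_itv/=; apply/andP; split.
  by near: s; exact: lt_nbhsr.
by near: s; exact: lt_nbhsl.
Unshelve. all: by end_near. Qed.

Theorem theorem2 (R : realType) (n N : nat) (T : nat -> R)
    (z : nat -> 'cV[R]_n) (f : 'cV[R]_n -> R -> 'cV[R]_n)
    (x u v : R -> 'cV[R]_n) (alpha : nat -> R)
    (hT : forall i, (i < N)%N -> T i < T i.+1)
    (hz : forall i, (i < N)%N -> z i.+1 <> z i)
    (hf : regular_field N T f)
    (hsol : PLinf_solution N T z f x u)
    (halpha : forall i, (i < N)%N ->
       (alpha i)%:E = ess_norm `[T i, T i.+1] u)
    (halpha_gt0 : forall i, (i < N)%N -> 0 < alpha i)
    (huv : forall i, (i < N)%N ->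
       {ae lebesgue_measure, forall t : R, t \in `[T i, T i.+1] ->
          u t = alpha i *: v t}) :
  exists (lambda : R -> 'cV[R]_n) (mu : R -> R),
    forall i, (i < N)%N ->
      (* lambda is W^{1,oo} on the open stage only, so it may jump at the T i *)
      (in_W1infty `]T i, T i.+1[ lambda /\ in_W1infty `[T i, T i.+1] mu) /\
      [/\ {ae lebesgue_measure, forall t : R, t \in `[T i, T i.+1] ->
             is_derive t (1 : R) x (f (x t) t + alpha i *: v t)},
          x (T i) = z i
        & x (T i.+1) = z i.+1] /\
      {ae lebesgue_measure, forall t : R, t \in `[T i, T i.+1] ->
         is_derive t (1 : R) lambda
           (- ((jacobian_x f (x t) t)^T *m lambda t))} /\
      [/\ {ae lebesgue_measure, forall t : R, t \in `[T i, T i.+1] ->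
             is_derive t (1 : R) mu
               (- 1 - \sum_(j < n) lambda t j 0 * v t j 0)},
          mu (T i) = 0
        & mu (T i.+1) = 0] /\
      {ae lebesgue_measure, forall t : R, t \in `[T i, T i.+1] ->
         forall j : 'I_n,
           [/\ lambda t j 0 < 0 -> v t j 0 = 1,
               lambda t j 0 > 0 -> v t j 0 = - 1
             & `|v t j 0| <= 1]}.
Proof.
have /choice[F HF] (i : nat) : exists F : (R -> 'cV[R]_n) * (R -> R) * (R -> R) * R,
    (i < N)%N ->
    let lambda := F.1.1.1 in let mu := F.1.1.2 in let g := F.1.2 in let K := F.2 in
  [/\ forall t : R, t \in `[T i, T i.+1] ->
        is_derive t 1 lambda (- ((jacobian_x f (x t) t)^T *m lambda t)),
      [/\ forall s t, s <= t -> `|mu t - mu s| <= K * (t - s), mu (T i) = 0 & mu (T i.+1) = 0],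
      forall t : R, is_derive t 1 mu (g t) /\ `|g t| <= K,
      {ae lebesgue_measure, forall t : R, t \in `[T i, T i.+1] ->
         g t = - 1 - \sum_(j < n) lambda t j 0 * v t j 0} &
      {ae lebesgue_measure, forall t : R, t \in `[T i, T i.+1] ->
         forall j : 'I_n,
           [/\ lambda t j 0 < 0 -> v t j 0 = 1,
               lambda t j 0 > 0 -> v t j 0 = - 1
             & `|v t j 0| <= 1]}].
  have [iN|iN] := boolP (i < N)%N; last by exists (fun=> 0, fun=> 0, fun=> 0, 0).
  have [lambda [mu [g [K H]]]] := stage_multiplier hT hf hsol halpha halpha_gt0 huv iN.
  by exists (lambda, mu, g, K).
pose lam i := (F i).1.1.1; pose m i := (F i).1.1.2.
have uniq_stage i k t : (i < N)%N -> (k < N)%N -> t \in `[T i, T i.+1[ ->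
    t \in `[T k, T k.+1[ -> k = i.
  move=> iN kN; rewrite !in_itv/= => /andP[h1 h2] /andP[h3 h4].
  have [ki|ik|//] := ltngtP k i.
    have := grid_le hT ki (ltnW iN).
    by move=> /(lt_le_trans h4)/lt_le_trans/(_ h1); rewrite ltxx.
  have := grid_le hT ik (ltnW kN).
  by move=> /(lt_le_trans h2)/lt_le_trans/(_ h3); rewrite ltxx.
(* Half-open stages are disjoint, so at most one summand is nonzero; at [T N] and outside the grid
   the sum is 0. *)
pose glue (V : zmodType) (G : nat -> R -> V) t :=
  \sum_(k < N) if t \in `[T k, T k.+1[ then G k t else 0.
have glueE (V : zmodType) (G : nat -> R -> V) i t : (i < N)%N -> t \in `[T i, T i.+1[ ->
    glue V G t = G i t.
  move=> iN ti; rewrite /glue (bigD1 (Ordinal iN))//= ti big1 ?addr0// => k ki.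
  case: ifP => // tk; case/eqP: ki; apply: val_inj; exact: uniq_stage iN _ ti tk.
exists (glue _ lam), (glue _ m) => i iN.
have ab : T i < T i.+1 := hT i iN.
have leab := ltW ab.
have [dl [mlip ma mb] dm gE sgn] := HF i iN.
have oo_co : {subset `]T i, T i.+1[ <= `[T i, T i.+1[}.
  by move=> t; rewrite !in_itv/= => /andP[/ltW -> ->].
have oo_cc : {subset `]T i, T i.+1[ <= `[T i, T i.+1]} by exact: subset_itv_oo_cc.
have cc_oo t : t \in `[T i, T i.+1] -> t != T i -> t != T i.+1 -> t \in `]T i, T i.+1[.
  by rewrite !in_itv/= => /andP[h1 h2] n1 n2; rewrite !lt_neqAle h1 h2 n2 eq_sym n1.
(* The end points of a stage are null, so almost-everywhere claims are checked in its interior,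
   where gluing leaves derivatives unchanged. *)
have stage_ae (P Q : R -> Prop) :
    {ae lebesgue_measure, forall t : R, t \in `[T i, T i.+1] -> Q t} ->
    (forall t, t \in `]T i, T i.+1[ -> Q t -> P t) ->
    {ae lebesgue_measure, forall t : R, t \in `[T i, T i.+1] -> P t}.
  move=> HQ PQ; apply: lebesgue_aeS (lebesgue_aeI HQ
    (lebesgue_aeI (lebesgue_ae_neq (T i)) (lebesgue_ae_neq (T i.+1)))) => t [Qt [n1 n2]] tab.
  by apply: PQ; [exact: cc_oo|exact: Qt].
have glue_derive (V : normedModType R) (G : nat -> R -> V) t (D : V) : t \in `]T i, T i.+1[ ->
    is_derive t 1 (G i) D -> is_derive t 1 (glue _ G) D.
  move=> tab; apply: near_eq_is_derive.
  by apply: filterS (near_itv_oo tab) => s sab; rewrite (glueE _ _ i)//; exact: oo_co.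
have dlam t : t \in `]T i, T i.+1[ ->
    is_derive t 1 (glue _ lam) (- ((jacobian_x f (x t) t)^T *m glue _ lam t)).
  move=> tab; rewrite (glueE _ lam i)//; last exact: oo_co.
  by apply: glue_derive => //; apply: dl; exact: oo_cc.
have sub : {subset `[T i, T i.+1] <= `[T 0, T N]} by exact: stage_sub.
(* A bound on the derivative of [lambda], serving both as Lipschitz constant and as essential
   bound. *)
have [C HC] : exists C, forall t, t \in `[T i, T i.+1] ->
    `|- ((jacobian_x f (x t) t)^T *m lam i t)| <= C.
  have [_ _ cJ] := hf.
  have cA : {within `[T i, T i.+1], continuous (fun t => jacobian_x f (x t) t)}.
    apply: (@continuous_subspaceW _ _ _ `[T 0, T N]%classic); first exact: sub.
    exact: continuous_along cJ (trajectory_continuous hsol).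
  have cl : {within `[T i, T i.+1], continuous (lam i)}.
    by apply: derivable_within_continuous => t /dl[].
  have [CA _ HA] := clamp_bounded leab cA.
  have [Cl _ Hl] := clamp_bounded leab cl.
  exists (n%:R * CA * Cl) => t tab.
  rewrite normrN (le_trans (mulmx_norm_le _ _))// ler_pM// ?mulr_ge0//.
    rewrite ler_wpM2l//; apply: (@le_trans _ _ `|jacobian_x f (x t) t|).
      by apply: mx_norm_le => // k j; rewrite mxE mx_entry_le.
    by have := HA t; rewrite clamp_id.
  by have := Hl t; rewrite clamp_id.
(* At [T i.+1] the glued function takes the initial value of the next stage, or the empty sum when
   [i.+1 = N]. Both are 0, the end value of [m i], so the identity extends to the closed stage. *)
have glue_m t : t \in `[T i, T i.+1] -> glue _ m t = m i t.
  rewrite in_itv/= => /andP[Tt]; rewrite le_eqVlt => /orP[/eqP ->|tT]; last first.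
    by rewrite (glueE _ _ i)// in_itv/= Tt.
  rewrite [RHS]mb; have [iN'|Ni] := ltnP i.+1 N.
    have [_ [_ mi _] _ _ _] := HF _ iN'.
    by rewrite (glueE _ _ i.+1)// in_itv/= lexx hT.
  rewrite /glue big1// => k _; case: ifP => //; rewrite in_itv/= => /andP[_].
  by rewrite ltNge (grid_le hT)// (leq_trans (ltn_ord k)).
have [[ax _ _] _ hx xz] := hsol.1.
split; [split|split; [|split; [|split]]].
- split.
  + apply: (@lipschitz_abs_continuous _ _ _ _ C) => s t sab tab st.
    rewrite !(glueE _ lam i)//; [|exact: oo_co|exact: oo_co].
    have dg (y : R) : y \in `[T i, T i.+1] -> is_derive y 1 (fun y : R => C * y) ((fun=> C) y).
      move=> _; apply: (is_derive_eq (is_deriveZ C (is_derive_id y (1 : R)))).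
      by rewrite /GRing.scale/= mulr1.
    rewrite mulrBr; move: sab tab; rewrite !in_itv/= => /andP[/ltW sa _] /andP[_ /ltW tb].
    exact: (mx_comparison dl dg HC sa st tb).
  + by apply: lebesgue_ae_nearW => t tab; have [] := dlam t tab.
  + apply/ess_norm_ltyP; exists C; apply: lebesgue_ae_nearW => t tab.
    rewrite derive1E; have [_ ->] := dlam t tab.
    by rewrite (glueE _ lam i)//; [apply: HC; exact: oo_cc|exact: oo_co].
- split.
  + apply: (@lipschitz_abs_continuous _ _ _ _ (F i).2) => s t sab tab st.
    by rewrite !glue_m//; exact: mlip.
  + apply: (stage_ae _ (fun=> True)); first exact: lebesgue_ae_nearW.
    move=> t tab _; have [dmt _] := dm t.
    by have [] := glue_derive _ m t _ tab dmt.
  + apply/ess_norm_ltyP; exists (F i).2.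
    apply: (stage_ae _ (fun=> True)); first exact: lebesgue_ae_nearW.
    move=> t tab _; have [dmt gK] := dm t.
    by rewrite derive1E; have [_ ->] := glue_derive _ m t _ tab dmt.
- split; [|by apply: xz; exact: ltnW|exact: xz].
  apply: lebesgue_aeS (lebesgue_aeI hx (huv i iN)) => t [H1 H2] tab.
  by rewrite -H2//; apply: H1; exact: sub.
- by apply: (stage_ae _ (fun=> True)) => [|t tab _]; [exact: lebesgue_ae_nearW|exact: dlam].
- split; [|by rewrite glue_m// in_itv/= lexx|by rewrite glue_m// in_itv/= lexx leab].
  apply: stage_ae gE _ => t tab gt.
  rewrite (glueE _ lam i)//; last exact: oo_co.
  by rewrite -gt; apply: glue_derive => //; have [] := dm t.
- apply: stage_ae sgn _ => t tab H j.
  by rewrite (glueE _ lam i)//; exact: oo_co.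
Qed.
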